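(* Let $X$ be a compact Hausdorff space, let $H$ be a separable Hilbert space, and let $\pi: C(X)\to B(H)$ be a unital representation. Denote also by $\pi:\mathcal{B}_b(X)\to B(H)$ its canonical extension to a unital representation of the $C^*$-algebra of bounded Borel measurable functions on $X$. Let $M\subset \mathcal{B}_b(X)$ be the monotone $\sigma$-completion of $C(X)$ in $\mathcal{B}_b(X)$. Then $\pi(M)$ is strongly closed, and hence $\pi(M)$ is equal to the von Neumann algebra generated by $\pi(C(X))$.
   Context: $C(X)$ is the $C^*$-algebra of continuous complex-valued functions on $X$, and $\mathcal{B}_b(X)$ is the $C^*$-algebra of bounded Borel measurable complex-valued functions on $X$ with the supremum norm and pointwise operations. A representation is a $*$-homomorphism into the algebra $B(H)$ of bounded operators on $H$. ''Strongly closed'' means closed in the strong operator topology of $B(H)$. Canonical extension: for each $\xi\in H$ let $\mu_\xi$ be the unique regular bounded positive Borel measure on $X$ such that $(\pi(f)\xi,\xi)=\int_X f\,d\mu_\xi$ for all $f\in C(X)$ (Riesz representation theorem). The representation $\pi$ of $C(X)$ extends uniquely to a unital representation $\pi$ of $\mathcal{B}_b(X)$ such that $(\pi(f)\xi,\xi)=\int_X f(x)\,d\mu_\xi(x)$ for all $f\in\mathcal{B}_b(X)$ and $\xi\in H$. A $C^*$-subalgebra $A$ of a $C^*$-algebra $B$ is monotone $\sigma$-closed in $B$ if, whenever $a_1\leq a_2\leq\ldots$ is a norm-bounded increasing sequence of self-adjoint elements of $A$ which has a supremum (least upper bound among the self-adjoint elements) in $B$, this supremum lies in $A$. The monotone $\sigma$-completion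 of $C(X)$ in $\mathcal{B}_b(X)$ (the Baire algebra) is the smallest monotone $\sigma$-closed $C^*$-subalgebra of $\mathcal{B}_b(X)$ containing $C(X)$. *)

(* Defs.v *)
From HB Require Import structures.
From mathcomp Require Import all_boot all_order all_algebra sesquilinear.
From mathcomp Require Import all_classical all_reals all_analysis.
From mathcomp Require Import complex.
Set Implicit Arguments.
Unset Strict Implicit.
Unset Printing Implicit Defensive.
Import Order.TTheory GRing.Theory Num.Theory.
Import numFieldNormedType.Exports.
Local Open Scope classical_set_scope.
Local Open Scope complex_scope.
Local Open Scope ring_scope.

(* The complex numbers R[i], packed as a numClosedFieldType: the topology and
   the normed space structure of MathComp-Analysis are attached to the
   structure numClosedFieldType and are not found on the bare type R[i]. *)
Definition Cplx (R : realType) : numClosedFieldType := R[i].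

Section FunctionAlgebras.
Context {R : realType} {X : topologicalType}.
Local Notation C := (Cplx R).
Implicit Types (f g : X -> C) (A B : set (X -> C)).

Definition fun_conj f : X -> C := fun x => Num.conj (f x).

Definition continuous_functions : set (X -> C) := [set f | continuous f].

(* [<<s @open X >>] is the Borel sigma-algebra of X. *)
Definition borel_function f : Prop :=
  forall U : set C, open U -> <<s @open X >> (f @^-1` U).

Definition bounded_borel_functions : set (X -> C) :=
  [set f | bounded_fun f /\ borel_function f].

Definition selfadjoint f : Prop := fun_conj f = f.

(* The order of C is partial: z <= w means that w - z is a nonnegative real, so
   this is the order in which f <= g iff g - f is a positive element. *)
Definition fun_le f g : Prop := forall x, f x <= g x.

(* A is a C*-subalgebra, not assumed to contain the unit, of the C*-algebra B
   of bounded functions; the uniform structure on X -> C is that of the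
   supremum norm. *)
Record Cstar_subalgebra B A : Prop := {
  Cstar_sub : A `<=` B ;
  Cstar_0 : A 0 ;
  Cstar_add : forall f g, A f -> A g -> A (f + g) ;
  Cstar_scale : forall (c : C) f, A f -> A (c *: f) ;
  Cstar_mul : forall f g, A f -> A g -> A (f * g) ;
  Cstar_conj : forall f, A f -> A (fun_conj f) ;
  Cstar_closed : B `&` closure (A : set {uniform X -> C}) `<=` A }.

(* s is the supremum of the sequence a among the self-adjoint elements of B. *)
Definition is_supremum_in B (a : nat -> X -> C) (s : X -> C) : Prop :=
  [/\ B s, selfadjoint s, forall n, fun_le (a n) s &
      forall t, B t -> selfadjoint t -> (forall n, fun_le (a n) t) ->
        fun_le s t].

Definition monotone_sigma_closed B A : Prop :=
  forall a : nat -> X -> C,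
    (forall n, A (a n) /\ selfadjoint (a n)) ->
    (forall n, fun_le (a n) (a n.+1)) ->
    (exists K : C, forall n x, `|a n x| <= K) ->
    forall s, is_supremum_in B a s -> A s.

Definition monotone_sigma_completion B A : set (X -> C) :=
  smallest (fun D => Cstar_subalgebra B D /\ monotone_sigma_closed B D) A.

End FunctionAlgebras.

Section BorelMeasures.
Context {R : realType} {X : topologicalType}.

(* The measurable types of the library are pointed. A topological space is
   turned into one by the choice of a point, which plays no other role. *)
Definition pointed_at (x0 : X) : Type := X.
HB.instance Definition _ (x0 : X) := Choice.copy (pointed_at x0) X.
HB.instance Definition _ (x0 : X) := isPointed.Build (pointed_at x0) x0.

Definition borelType (x0 : X) :=
  g_sigma_algebraType (@open X : set (set (pointed_at x0))).

Definition regular_measure (x0 : X)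
    (mu : {finite_measure set (borelType x0) -> \bar R}) : Prop :=
  forall A : set (borelType x0), measurable A ->
    mu A = ereal_inf [set mu U | U in [set U | @open X U /\ A `<=` U]] /\
    mu A = ereal_sup [set mu K | K in [set K | @compact X K /\ K `<=` A]].

Definition complex_integral (x0 : X)
    (mu : {finite_measure set (borelType x0) -> \bar R})
    (f : X -> Cplx R) : Cplx R :=
  (\int[mu]_x complex.Re (f x)) +i* (\int[mu]_x complex.Im (f x)).

End BorelMeasures.

Section Operators.
Context {R : realType} {H : completeNormedModType (Cplx R)}.
Local Notation C := (Cplx R).
Variable dot : {dot H for Num.conj}.
Implicit Types (S T : H -> H) (A : set (H -> H)).

Definition bounded_operators : set (H -> H) :=
  [set T | linear T /\ exists K : C, forall u, `|T u| <= K * `|u|].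

Definition adjoint T S : Prop := forall u v, dot (T u) v = dot u (S v).

(* The strong operator topology is that of pointwise convergence in norm. *)
Definition strongly_closed A : Prop :=
  bounded_operators `&` closure (A : set {ptws H -> H}) `<=` A.

Record von_neumann_algebra A : Prop := {
  vn_sub : A `<=` bounded_operators ;
  vn_id : A idfun ;
  vn_add : forall S T, A S -> A T -> A (S + T) ;
  vn_scale : forall (c : C) T, A T -> A (c *: T) ;
  vn_comp : forall S T, A S -> A T -> A (S \o T) ;
  vn_adjoint : forall T S, A T -> adjoint T S -> A S ;
  vn_closed : strongly_closed A }.

Definition generated_von_neumann_algebra A : set (H -> H) :=
  smallest von_neumann_algebra A.

End Operators.

Section Representations.
Context {R : realType} {X : topologicalType} {H : completeNormedModType (Cplx R)}.
Local Notation C := (Cplx R).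
Variable dot : {dot H for Num.conj}.

(* pi is a unital *-homomorphism from the function algebra A to B(H); the values
   of pi outside A are irrelevant. *)
Record unital_representation (A : set (X -> C)) (pi : (X -> C) -> H -> H)
    : Prop := {
  rep_bounded : forall f, A f -> bounded_operators (pi f) ;
  rep_add : forall f g, A f -> A g -> pi (f + g) = pi f + pi g ;
  rep_scale : forall (c : C) f, A f -> pi (c *: f) = c *: pi f ;
  rep_mul : forall f g, A f -> A g -> pi (f * g) = pi f \o pi g ;
  rep_conj : forall f, A f -> adjoint dot (pi f) (pi (fun_conj f)) ;
  rep_one : pi 1 = idfun }.

(* The measure mu_u of u is the Riesz measure of f |-> (pi f u, u) on C(X).
   When X is empty both algebras are zero and there is no measure to provide. *)
Record canonical_extension (pi piB : (X -> C) -> H -> H) : Prop := {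
  ext_rep : unital_representation bounded_borel_functions piB ;
  ext_extends : forall f, continuous_functions f -> piB f = pi f ;
  ext_integral : forall (x0 : X) (u : H),
    exists mu : {finite_measure set (borelType x0) -> \bar R},
      [/\ regular_measure mu,
          forall f, continuous_functions f ->
            dot (pi f u) u = complex_integral mu f &
          forall f, bounded_borel_functions f ->
            dot (piB f u) u = complex_integral mu f] }.

End Representations.

(* Main.v *)
Require Import Defs.
From mathcomp Require Import all_boot all_order all_algebra sesquilinear.
From mathcomp Require Import all_classical all_reals all_analysis.
From mathcomp Require Import complex measurable_realfun.
From mathcomp Require Import ring lra.

(** The monotone sigma-completion M of C(X) consists of the bounded functions
    that are measurable for the sigma-algebra generated by the cozero sets.
    Since |pi(f) u|^2 is the integral of |f|^2 for mu_u, bounded pointwise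
    limits of sequences become strong limits; this puts pi(M) inside every von
    Neumann algebra that contains pi(C(X)).

    Let T be a bounded operator in the strong closure of pi(M). As H is
    separable there are f_n in M such that pi(f_n) xi_k converges to T xi_k
    very fast, for every term xi_k of a dense sequence. Then (f_n) converges in
    L^2(mu_(xi_k)) so fast that it converges off a set that is null for all the
    mu_(xi_k), say to F. On the sets where the f_n are uniformly bounded, pi(F)
    agrees with T, because T commutes with pi(M); as T is bounded, the part
    where |F| is large is annihilated by pi, so that F may be replaced by a
    bounded function f of M, and T = pi(f). *)

Set Implicit Arguments.
Unset Strict Implicit.
Unset Printing Implicit Defensive.
Import Order.TTheory GRing.Theory Num.Theory.
Import numFieldNormedType.Exports.
Local Open Scope classical_set_scope.
Local Open Scope complex_scope.
Local Open Scope ring_scope.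

(** * Complex numbers and complex measurable functions *)

Section ComplexNumbers.
Context {R : realType}.
Local Notation C := (Cplx R).
Implicit Types z w : C.

Definition cre z : R := complex.Re z.
Definition cim z : R := complex.Im z.
(** The squared modulus as a real number: the norm of [C] is complex-valued, while integrals and
    limits are taken in [R]. *)
Definition sqn z : R := cre z ^+ 2 + cim z ^+ 2.

Lemma creD z w : cre (z + w) = cre z + cre w.
Proof. by case: z w => [a b] [c e]. Qed.

Lemma cimD z w : cim (z + w) = cim z + cim w.
Proof. by case: z w => [a b] [c e]. Qed.

Lemma creN z : cre (- z) = - cre z.
Proof. by case: z. Qed.

Lemma cimN z : cim (- z) = - cim z.
Proof. by case: z. Qed.

Lemma creM z w : cre (z * w) = cre z * cre w - cim z * cim w.
Proof. by case: z w => [a b] [c e]. Qed.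

Lemma cimM z w : cim (z * w) = cre z * cim w + cim z * cre w.
Proof. by case: z w => [a b] [c e]. Qed.

Lemma cre_conj z : cre (Num.conj z) = cre z.
Proof. by case: z. Qed.

Lemma cim_conj z : cim (Num.conj z) = - cim z.
Proof. by case: z. Qed.

Lemma cplx_eq z w : cre z = cre w -> cim z = cim w -> z = w.
Proof. by case: z w => [a b] [c e] /= -> ->. Qed.

Lemma cplx_le z w : (z <= w) = (cim w == cim z) && (cre z <= cre w).
Proof. exact: lecE. Qed.

Lemma cplx_lt z w : (z < w) = (cim w == cim z) && (cre z < cre w).
Proof. exact: ltcE. Qed.

Lemma sqn_ge0 z : 0 <= sqn z.
Proof. by rewrite addr_ge0 ?sqr_ge0. Qed.

Lemma sqnE z : (sqn z)%:C = `|z| ^+ 2.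
Proof. exact: add_Re2_Im2. Qed.

Lemma sqnM z w : sqn (z * w) = sqn z * sqn w.
Proof. rewrite /sqn creM cimM; ring. Qed.

Lemma sqnN z : sqn (- z) = sqn z.
Proof. by rewrite /sqn creN cimN !sqrrN. Qed.

(** Parallelogram law: the two sides differ by [sqn (z - w)]. *)
Lemma sqnD_le z w : sqn (z + w) <= 2 * (sqn z + sqn w).
Proof.
rewrite /sqn creD cimD.
have := sqr_ge0 (cre z - cre w); have := sqr_ge0 (cim z - cim w).
nra.
Qed.

Lemma sqn_conj z : sqn (Num.conj z) = sqn z.
Proof. by rewrite /sqn cre_conj cim_conj sqrrN. Qed.

Lemma sqn_real (r : R) : sqn (r%:C : C) = r ^+ 2.
Proof. by rewrite /sqn /cre /cim /= expr0n addr0. Qed.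

Lemma conj_mulE z : Num.conj z * z = (sqn z)%:C.
Proof. by rewrite sqnE normCK mulrC. Qed.

Lemma cre_norm_ge0 z : 0 <= cre `|z|.
Proof. by have := normr_ge0 z; rewrite cplx_le => /andP[]. Qed.

Lemma norm_creE z : `|z| = (cre `|z|)%:C.
Proof.
have := normr_ge0 z; rewrite cplx_le => /andP[/eqP h _].
exact: cplx_eq.
Qed.

Lemma sqn_norm z : sqn z = cre `|z| ^+ 2.
Proof. by have := sqnE z; rewrite norm_creE -rmorphXn => -[]. Qed.

Lemma norm_le_sqn z (K : C) : `|z| <= K -> sqn z <= cre K ^+ 2.
Proof.
rewrite cplx_le sqn_norm => /andP[_ h].
by rewrite ler_pXn2r ?nnegrE ?cre_norm_ge0 // (le_trans (cre_norm_ge0 z)).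
Qed.

Lemma cre_norm_le z : `|cre z| <= cre `|z|.
Proof. by have := normc_ge_Re z; rewrite cplx_le => /andP[]. Qed.

Lemma cim_norm_le z : `|cim z| <= cre `|z|.
Proof.
rewrite -(ler_pXn2r (n:=2)) ?nnegrE ?cre_norm_ge0 // -sqn_norm.
by rewrite real_normK ?num_real // /sqn lerDr sqr_ge0.
Qed.

Lemma cre_continuous : continuous (cre : C -> R).
Proof.
move=> z U /nbhs_ballP[e /= e0 eU].
have eC : (0 : C) < e%:C by rewrite cplx_lt /= eqxx.
apply: filterS (@nbhsx_ballx _ _ z e%:C eC) => w zw; apply: eU.
move: zw; rewrite -!ball_normE /ball_ /=.
rewrite cplx_lt -creN -creD => /andP[_]; apply: le_lt_trans.
exact: cre_norm_le.
Qed.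

Lemma cim_continuous : continuous (cim : C -> R).
Proof.
move=> z U /nbhs_ballP[e /= e0 eU].
have eC : (0 : C) < e%:C by rewrite cplx_lt /= eqxx.
apply: filterS (@nbhsx_ballx _ _ z e%:C eC) => w zw; apply: eU.
move: zw; rewrite -!ball_normE /ball_ /=.
rewrite cplx_lt -cimN -cimD => /andP[_]; apply: le_lt_trans.
exact: cim_norm_le.
Qed.

Lemma real_complex_continuous : continuous (fun r : R => (r%:C : C)).
Proof.
move=> r U /nbhs_ballP[e /= e0 eU].
have := e0; rewrite cplx_lt => /andP[ei e1].
apply: filterS (@nbhsx_ballx _ _ r (cre e) e1) => s rs; apply: eU.
move: rs; rewrite -!ball_normE /ball_ /= => rs.
rewrite -rmorphB normc_def /= expr0n addr0 sqrtr_sqr.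
by rewrite cplx_lt ei.
Qed.

(** The squares with rational centre and half-side form a countable base of the plane. *)
Lemma open_rat_rect (U : set C) z : open U -> U z ->
  exists q : (rat * rat) * rat,
    [/\ `|cre z - ratr q.1.1| < ratr q.2, `|cim z - ratr q.1.2| < ratr q.2 &
     forall w, `|cre w - ratr q.1.1| < ratr q.2 ->
       `|cim w - ratr q.1.2| < ratr q.2 -> U w].
Proof.
move=> oU Uz.
have /nbhs_ballP[e /= e0 eU] : nbhs z U by exact: open_nbhs_nbhs.
have e1 : 0 < cre e by move: e0; rewrite cplx_lt => /andP[].
have [r] := @rat_in_itvoo R _ _ e1; rewrite in_itv/= => /andP[r0 re].
(* The centre is taken within [r / 4] of [z] in each coordinate and the half-side is [r / 4]; points
   of the square are then within [r / 2] of [z] in each coordinate, hence within [r] in modulus. *)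
have r3 : 0 < ratr r / 4 :> R by rewrite divr_gt0.
have ap t : exists q, `|t - ratr q| < ratr r / 4 :> R.
  have : t < t + ratr r / 4 by rewrite ltrDl.
  move=> /rat_in_itvoo[q]; rewrite in_itv /= => /andP[q1 q2]; exists q.
  by rewrite ltr_distlC; apply/andP; split; lra.
have [a za] := ap (cre z); have [b zb] := ap (cim z).
exists ((a, b), r / 4); rewrite fmorph_div /= ratr_nat; split=> // w wa wb.
apply: eU; rewrite -ball_normE /ball_ /=.
rewrite norm_creE cplx_lt; apply/andP; split.
  by move: e0; rewrite cplx_lt => /andP[].
apply: (le_lt_trans _ re); change (cre `|z - w| <= ratr r :> R).
rewrite -(ler_pXn2r (n:=2)) ?nnegrE ?cre_norm_ge0 //; last exact: ltW.
rewrite -sqn_norm /sqn creD cimD creN cimN.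
have ha : `|cre z - cre w| <= ratr r / 2 :> R.
  by apply: (le_trans (ler_distD (ratr a) _ _)); rewrite (distrC (ratr a)); lra.
have hb : `|cim z - cim w| <= ratr r / 2 :> R.
  by apply: (le_trans (ler_distD (ratr b) _ _)); rewrite (distrC (ratr b)); lra.
have sq x : `|x| <= ratr r / 2 :> R -> x ^+ 2 <= (ratr r / 2) ^+ 2.
  move=> hx; rewrite -[x^+2]real_normK ?num_real // ler_pXn2r ?nnegrE //.
  lra.
have := sq _ ha; have := sq _ hb; nra.
Qed.

End ComplexNumbers.

Section ComplexMeasurability.
Context {R : realType} {d : measure_display} {T : measurableType d}.
Local Notation C := (Cplx R).
Implicit Types f g : T -> C.

Definition cmeasurable f : Prop :=
  measurable_fun setT (fun x => cre (f x)) /\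
  measurable_fun setT (fun x => cim (f x)).

(** An open set is a countable union of rational squares. Conversely, real and imaginary parts are
    continuous and open rays generate the Borel sets of [R]. *)
Lemma cmeasurableP f :
  cmeasurable f <-> forall U : set C, open U -> measurable (f @^-1` U).
Proof.
split=> [[fr fi] U oU|h].
  pose rect (q : (rat * rat) * rat) : set C := [set w |
    `|cre w - ratr q.1.1| < ratr q.2 /\ `|cim w - ratr q.1.2| < ratr q.2].
  have -> : f @^-1` U =
      \bigcup_(q in [set q | rect q `<=` U]) (f @^-1` rect q).
    apply/seteqP; split=> [x /= Ux|x [q /= qU] /qU //].
    have [q [q1 q2 qU]] := open_rat_rect oU Ux.
    by exists q => // w [w1 w2]; exact: qU.
  (* Reindexing by all rational triples, a countable type: squares that are not contained in [U]
     contribute [set0]. *)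
  have -> : \bigcup_(q in [set q | rect q `<=` U]) (f @^-1` rect q) =
      \bigcup_q (if `[< rect q `<=` U >] then f @^-1` rect q else set0).
    apply/seteqP; split=> [x [q qU fq]|x [q _]].
      by exists q => //; rewrite asboolT.
    by case: asboolP => // qU fq; exists q.
  apply: countable_bigcupT_measurable => // q; case: ifPn => // _.
  have ball_m (g : T -> R) (a r : R) : measurable_fun setT g ->
      measurable [set x | `|g x - a| < r].
    move=> mg; have : measurable_fun setT (fun x => `|g x - a|).
      by apply: measurableT_comp => //; exact: measurable_funB.
    move=> /measurable_fun_ltr/(_ (measurable_cst r)).
    by move=> /(_ measurableT [set true]); rewrite setTI; apply.
  have -> : f @^-1` rect q =
     [set x | `|cre (f x) - ratr q.1.1| < ratr q.2] `&`
     [set x | `|cim (f x) - ratr q.1.2| < ratr q.2] by [].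
  by apply: measurableI; exact: ball_m.
have main (p : C -> R) : continuous p -> measurable_fun setT (fun x => p (f x)).
  move=> cp; apply: (measurability _ (RGenOInfty.measurableE R)).
  move=> _ [_ [a ->] <-]; rewrite setTI.
  apply: (h (p @^-1` `]a, +oo[%classic)).
  by apply: open_comp => //; exact: interval_open.
by split; apply: main; [exact: cre_continuous|exact: cim_continuous].
Qed.

Lemma cmeasurable_cst (c : C) : cmeasurable (fun=> c).
Proof. by split; exact: measurable_cst. Qed.

Lemma cmeasurableD f g : cmeasurable f -> cmeasurable g -> cmeasurable (f + g).
Proof.
move=> [f1 f2] [g1 g2]; split.
  under eq_fun do rewrite creD; exact: measurable_funD.
under eq_fun do rewrite cimD; exact: measurable_funD.
Qed.

Lemma cmeasurableM f g : cmeasurable f -> cmeasurable g -> cmeasurable (f * g).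
Proof.
move=> [f1 f2] [g1 g2]; split.
  under eq_fun do rewrite creM.
  by apply: measurable_funB; exact: measurable_funM.
under eq_fun do rewrite cimM.
by apply: measurable_funD; exact: measurable_funM.
Qed.

Lemma cmeasurable_conj f : cmeasurable f -> cmeasurable (fun x => Num.conj (f x)).
Proof.
move=> [f1 f2]; split.
  by under eq_fun do rewrite cre_conj.
under eq_fun do rewrite cim_conj; exact: measurableT_comp.
Qed.

Lemma cmeasurable_sqn f : cmeasurable f -> measurable_fun setT (fun x => sqn (f x)).
Proof.
move=> [f1 f2]; rewrite /sqn.
by apply: measurable_funD; exact: measurable_funX.
Qed.

Lemma cmeasurable_cvg (a : nat -> T -> C) f : (forall n, cmeasurable (a n)) ->
  (forall x, cre (a n x) @[n --> \oo] --> cre (f x)) ->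
  (forall x, cim (a n x) @[n --> \oo] --> cim (f x)) -> cmeasurable f.
Proof.
move=> ma ar ai; split.
  apply: (@measurable_fun_cvg _ _ _ setT (fun n x => cre (a n x))) => //.
  by move=> n; exact: (ma n).1.
apply: (@measurable_fun_cvg _ _ _ setT (fun n x => cim (a n x))) => //.
by move=> n; exact: (ma n).2.
Qed.

End ComplexMeasurability.

(** * Bounded measurable functions *)

Section ComplexSequences.
Context {R : realType}.
Local Notation C := (Cplx R).

Definition ccvg (u : nat -> C) (z : C) : Prop :=
  cre (u n) @[n --> \oo] --> cre z /\ cim (u n) @[n --> \oo] --> cim z.

Lemma ccvg_sqn (u : nat -> C) z : ccvg u z ->
  sqn (u n - z) @[n --> \oo] --> (0 : R).
Proof.
move=> [ur ui].
have -> : (fun n => sqn (u n - z)) =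
    (fun n => (cre (u n) - cre z) * (cre (u n) - cre z) +
              (cim (u n) - cim z) * (cim (u n) - cim z)).
  by apply/funext => n; rewrite /sqn creD cimD creN cimN !expr2.
rewrite -[0 in X in _ --> X](_ : (cre z - cre z) * (cre z - cre z) +
  (cim z - cim z) * (cim z - cim z) = 0); last by rewrite !subrr mulr0 addr0.
by apply: cvgD; apply: cvgM; apply: cvgB => //; exact: cvg_cst.
Qed.

Lemma sqn_ccvg (u : nat -> C) z (e : nat -> R) :
  (forall n, sqn (u n - z) <= e n ^+ 2) -> (forall n, 0 <= e n) ->
  e n @[n --> \oo] --> 0 -> ccvg u z.
Proof.
move=> ue e0 cve.
have h (p : C -> R) : (forall w, p w ^+ 2 <= sqn w) ->
    (forall w w', p (w - w') = p w - p w') -> p (u n) @[n --> \oo] --> p z.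
  move=> ps pB; apply/subr_cvg0; apply: norm_cvg0.
  apply: (squeeze_cvgr _ (@cvg_cst _ (0 : R) _ _ _) cve).
  apply: nearW => n; rewrite normr_ge0 /=.
  rewrite -(ler_pXn2r (n:=2)) ?nnegrE // real_normK ?num_real // -pB.
  exact: le_trans (ps _) (ue n).
split; apply: h.
- by move=> w; rewrite /sqn lerDl sqr_ge0.
- by move=> w w'; rewrite creD creN.
- by move=> w; rewrite /sqn lerDr sqr_ge0.
- by move=> w w'; rewrite cimD cimN.
Qed.

End ComplexSequences.

Section BoundedFunctions.
Context {R : realType} {X : choiceType}.
Local Notation C := (Cplx R).
Implicit Types f g : X -> C.

(** Boundedness is read along the filter [globally [set: X]], which is proper thanks to the point
    [x0]. *)
Lemma bounded_sqnP (x0 : X) f :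
  bounded_fun f <-> exists K : R, forall x, sqn (f x) <= K.
Proof.
have PF : ProperFilter (globally [set: X]) by exact: globally_properfilter x0 I.
split=> [/ex_bound[M fM]|[K fK]].
  by exists (cre M ^+ 2) => x; apply: norm_le_sqn; exact: fM.
apply/ex_bound; exists (Num.sqrt K)%:C => x _ /=.
rewrite normc_def cplx_le eqxx /=; apply: ler_wsqrtr; exact: fK.
Qed.

Lemma closure_uniformP (A : set (X -> C)) f :
  closure (A : set {uniform X -> C}) f ->
  forall e : R, 0 < e -> exists2 g, A g & forall x, sqn (g x - f x) <= e ^+ 2.
Proof.
move=> cf e e0.
have eC : (0 : C) < e%:C by rewrite cplx_lt /= eqxx.
have [|g [Ag /= fg]] := cf [set g | forall x, ball (f x) (e%:C : C) (g x)].
  apply/uniform_nbhs; exists [set p | ball p.1 (e%:C : C) p.2]; split.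
    by rewrite -entourage_ballE; exists e%:C.
  by move=> g /= fg x; exact: fg.
exists g => // x; have := fg x; rewrite -ball_normE /ball_ /= => /ltW.
by rewrite -sqnN opprB => /norm_le_sqn.
Qed.

(** The radii [1 / (n + 1)] force convergence, and as they are at most 1 they also give the uniform
    bound that later limit arguments require. *)
Lemma closure_uniform_seq (A : set (X -> C)) f :
  closure (A : set {uniform X -> C}) f ->
  exists2 g : nat -> X -> C, forall n, A (g n) &
    (forall x, ccvg (g^~ x) (f x)) /\ forall n x, sqn (g n x - f x) <= 1.
Proof.
move=> /closure_uniformP cf.
have /choice[g hg] (n : nat) : exists g, A g /\
    forall x, sqn (g x - f x) <= (n.+1%:R^-1) ^+ 2.
  by have [g Ag gf] := cf (n.+1%:R^-1) ltac:(by []); exists g.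
exists g => [n|]; first exact: (hg n).1.
split=> [x|n x].
  apply: (@sqn_ccvg _ _ _ (fun n => n.+1%:R^-1)) => //.
  - by move=> n; exact: (hg n).2.
  - exact: cvg_harmonic.
apply: le_trans ((hg n).2 x) _.
by rewrite exprn_ile1 ?invr_ge0 // invf_le1 // ler1n.
Qed.

End BoundedFunctions.

(* With G the open sets this is B_b(X), with G the cozero sets the Baire
   algebra. *)
Definition bounded_measurable {R : realType} {X : choiceType}
    (G : set (set X)) : set (X -> Cplx R) :=
  [set f | bounded_fun f /\
    forall U : set (Cplx R), open U -> <<s G >> (f @^-1` U)].

Section BoundedMeasurable.
Context {R : realType} {X : topologicalType}.
Local Notation C := (Cplx R).
Variable x0 : X.
Implicit Types (G : set (set X)) (f g : X -> C).

Definition sigmaType G : measurableType _ :=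
  g_sigma_algebraType (G : set (set (pointed_at x0))).

Lemma bounded_measurableP G f : bounded_measurable G f <->
  (exists K : R, forall x, sqn (f x) <= K) /\ cmeasurable (f : sigmaType G -> C).
Proof.
split=> [[/(bounded_sqnP x0) bf mf]|[/(bounded_sqnP x0) bf mf]]; split => //.
  exact: (@cmeasurableP _ _ (sigmaType G) f).2 mf.
exact: (@cmeasurableP _ _ (sigmaType G) f).1 mf.
Qed.

Lemma bounded_measurable_cst G (c : C) : bounded_measurable G (fun=> c).
Proof.
apply/bounded_measurableP; split; first by exists (sqn c).
exact: cmeasurable_cst.
Qed.

Lemma bounded_measurableD G f g : bounded_measurable G f ->
  bounded_measurable G g -> bounded_measurable G (f + g).
Proof.
move=> /bounded_measurableP[[K fK] mf] /bounded_measurableP[[L gL] mg].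
apply/bounded_measurableP; split; last exact: cmeasurableD.
exists (2 * (K + L)) => x; apply: le_trans (sqnD_le _ _) _.
by rewrite ler_pM2l // lerD.
Qed.

Lemma bounded_measurableM G f g : bounded_measurable G f ->
  bounded_measurable G g -> bounded_measurable G (f * g).
Proof.
move=> /bounded_measurableP[[K fK] mf] /bounded_measurableP[[L gL] mg].
apply/bounded_measurableP; split; last exact: cmeasurableM.
by exists (K * L) => x; rewrite sqnM ler_pM ?sqn_ge0.
Qed.

Lemma bounded_measurableZ G (c : C) f : bounded_measurable G f ->
  bounded_measurable G (c *: f).
Proof.
by move=> mf; apply: (bounded_measurableM (bounded_measurable_cst _ c) mf).
Qed.

Lemma bounded_measurable_conj G f : bounded_measurable G f ->
  bounded_measurable G (fun_conj f).
Proof.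
move=> /bounded_measurableP[[K fK] mf].
apply/bounded_measurableP; split; last exact: cmeasurable_conj.
by exists K => x; rewrite sqn_conj.
Qed.

Lemma bounded_measurable_cvg G (a : nat -> X -> C) f (K : R) :
  (forall n, bounded_measurable G (a n)) -> (forall x, ccvg (a^~ x) (f x)) ->
  (forall x, sqn (f x) <= K) -> bounded_measurable G f.
Proof.
move=> ma af fK; apply/bounded_measurableP; split; first by exists K.
apply: (@cmeasurable_cvg _ _ (sigmaType G) a) => [n|x|x].
- by have /bounded_measurableP[] := ma n.
- by have [] := af x.
- by have [] := af x.
Qed.

Lemma bounded_measurable_closed G f :
  closure (bounded_measurable G : set {uniform X -> C}) f ->
  bounded_measurable G f.
Proof.
move=> /closure_uniform_seq[g mg [gf gb]].
have /bounded_measurableP[[K gK] _] := mg 0%N.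
(* The bound comes from writing [f] as [(f - g 0) + g 0], with [f - g 0] of modulus at most 1. *)
apply: (@bounded_measurable_cvg _ g _ (2 * (1 + K))) => // x.
rewrite -[f x](subrK (g 0%N x)); apply: le_trans (sqnD_le _ _) _.
by rewrite ler_pM2l // lerD // -sqnN opprB.
Qed.

Lemma bounded_measurable_sub G : <<s G >> `<=` <<s @open X >> ->
  bounded_measurable G `<=` (bounded_borel_functions : set (X -> C)).
Proof. by move=> GX f [bf mf]; split=> // U oU; apply: GX; exact: mf. Qed.

Lemma bounded_measurable_Cstar G : <<s G >> `<=` <<s @open X >> ->
  Cstar_subalgebra bounded_borel_functions
    (bounded_measurable G : set (X -> C)).
Proof.
move=> GX; split.
- exact: bounded_measurable_sub.
- exact: bounded_measurable_cst.
- exact: bounded_measurableD.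
- exact: bounded_measurableZ.
- exact: bounded_measurableM.
- exact: bounded_measurable_conj.
- by move=> f [_]; exact: bounded_measurable_closed.
Qed.

Lemma selfadjoint_cim f : selfadjoint f -> forall x, cim (f x) = 0.
Proof.
move=> sf x; have := congr1 (fun g => cim (g x)) sf.
by rewrite /fun_conj cim_conj => /eqP; rewrite eq_sym -addr_eq0 -mulr2n
  mulrn_eq0 => /eqP.
Qed.

Lemma cim_selfadjoint f : (forall x, cim (f x) = 0) -> selfadjoint f.
Proof.
move=> f0; apply/funext => x; apply: cplx_eq; first exact: cre_conj.
by rewrite /fun_conj cim_conj f0 oppr0.
Qed.

(** Suprema in B_b(X) of increasing sequences are pointwise limits: the pointwise limit [t] is
    itself a bounded Borel upper bound, so [s <= t], while [t <= s] because [s] bounds every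
    term. *)
Lemma supremum_ccvg (a : nat -> X -> C) s :
  (forall n, bounded_borel_functions (a n) /\ selfadjoint (a n)) ->
  (forall n, fun_le (a n) (a n.+1)) ->
  is_supremum_in bounded_borel_functions a s ->
  forall x, ccvg (a^~ x) (s x).
Proof.
move=> ma ai [ms ss as_ sl].
have nd x : nondecreasing_seq (fun n => cre (a n x)).
  apply/nondecreasing_seqP => n; have := ai n x.
  by rewrite cplx_le => /andP[].
have ub x n : cre (a n x) <= cre (s x).
  by have := as_ n x; rewrite cplx_le => /andP[].
have cva x : cvgn (fun n => cre (a n x)).
  by apply: nondecreasing_is_cvgn => //; exists (cre (s x)) => _ [n _ <-].
pose t x : C := (limn (fun n => cre (a n x)))%:C.
have at_ x : ccvg (a^~ x) (t x).
  split => //; rewrite (_ : (fun n => _) = cst 0); first exact: cvg_cst.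
  by apply/funext => n; rewrite (selfadjoint_cim (ma n).2).
have ts x : cre (t x) <= cre (s x).
  by apply: limr_le => //; apply: nearW => n; exact: ub.
have alet n : fun_le (a n) t.
  move=> x; rewrite cplx_le (selfadjoint_cim (ma n).2) eqxx /=.
  exact: (nondecreasing_cvgn_le (nd x)).
have mt : bounded_borel_functions t.
  have /bounded_measurableP[[K sK] _] : bounded_measurable (@open X) s by [].
  have /bounded_measurableP[[L aL] _] : bounded_measurable (@open X) (a 0%N).
    exact: (ma 0%N).1.
  (* The limit lies between [a 0] and [s], so its square is at most the larger of theirs, hence at
     most [K + L]. *)
  apply: (@bounded_measurable_cvg (@open X) a t (K + L)) => // [n|x].
    exact: (ma n).1.
  rewrite sqn_real.
  have := sK x; have := aL x; rewrite /sqn.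
  rewrite (selfadjoint_cim ss) (selfadjoint_cim (ma 0%N).2) expr0n /= !addr0.
  have := ts x; have := alet 0%N x; rewrite cplx_le => /andP[_].
  set l := limn _; rewrite (_ : cre (t x) = l) //.
  move: (cre _) (cre _) => u v ul vl hu hv.
  by have [l0|l0] := leP 0 l; nra.
have st : s = t.
  apply/funext => x; apply: cplx_eq; last by rewrite (selfadjoint_cim ss).
  apply/eqP; rewrite eq_le ts andbT.
  have : fun_le s t by apply: sl => //; exact: cim_selfadjoint.
  by move=> /(_ x); rewrite cplx_le => /andP[].
by move=> x; rewrite st.
Qed.

Lemma bounded_measurable_monotone G : <<s G >> `<=` <<s @open X >> ->
  monotone_sigma_closed bounded_borel_functions
    (bounded_measurable G : set (X -> C)).
Proof.
move=> GX a ma ai _ s ss.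
have sa n : bounded_borel_functions (a n) /\ selfadjoint (a n).
  by split; [exact/(bounded_measurable_sub GX)/(ma n).1|exact: (ma n).2].
have [ms _ _ _] := ss.
have /bounded_measurableP[[K sK] _] : bounded_measurable (@open X) s by [].
apply: (@bounded_measurable_cvg _ a s K) => // [n|x]; first exact: (ma n).1.
exact: supremum_ccvg.
Qed.

(** Converse to [supremum_ccvg]: a bounded increasing pointwise limit is Borel, and every upper
    bound dominates it pointwise, so it is the supremum in B_b(X). All membership proofs below that
    pass to a limit in [D] use this form. *)
Lemma monotone_sigma_closed_ccvg D (a : nat -> X -> C) s (K : R) :
  monotone_sigma_closed bounded_borel_functions D ->
  D `<=` bounded_borel_functions ->
  (forall n, D (a n)) ->
  (forall n x, cim (a n x) = 0) ->
  (forall n x, 0 <= cre (a n x) <= K) ->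
  (forall n x, cre (a n x) <= cre (a n.+1 x)) ->
  (forall x, cim (s x) = 0) ->
  (forall x, cre (a n x) @[n --> \oo] --> cre (s x)) -> D s.
Proof.
move=> mD DB Da ai aK nd si cv.
have nds x : nondecreasing_seq (fun n => cre (a n x)).
  by apply/nondecreasing_seqP => n; exact: nd.
have lims x : limn (fun n => cre (a n x)) = cre (s x) by exact: cvg_lim.
have cvs x : cvgn (fun n => cre (a n x)) by apply/cvg_ex; exists (cre (s x)).
have ub n x : cre (a n x) <= cre (s x).
  by rewrite -lims; exact: nondecreasing_cvgn_le.
have sK x : cre (s x) <= K.
  rewrite -lims; apply: limr_le => //; apply: nearW => n.
  by have /andP[] := aK n x.
apply: (mD a).
- by move=> n; split; [exact: Da|exact: cim_selfadjoint].
- by move=> n x; rewrite cplx_le !ai eqxx nd.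
- exists K%:C => n x; rewrite normc_def cplx_le eqxx /=.
  rewrite [complex.Im _]ai expr0n addr0 sqrtr_sqr.
  by have /andP[h1 h2] := aK n x; rewrite ger0_norm.
split.
- apply: (@bounded_measurable_cvg (@open X) a s (K ^+ 2)) => [n|x|x].
  + exact/DB/Da.
  + split => //; rewrite si (_ : (fun n => _) = cst 0); first exact: cvg_cst.
    by apply/funext => n; rewrite ai.
  + rewrite /sqn si expr0n addr0 ler_pXn2r ?nnegrE //.
      by apply: le_trans (ub 0%N x); have /andP[] := aK 0%N x.
    have /andP[h1 h2] := aK 0%N x; exact: le_trans h2.
- exact: cim_selfadjoint.
- by move=> n x; rewrite cplx_le ai si eqxx ub.
- move=> t Bt st at_ x; rewrite cplx_le si (selfadjoint_cim st) eqxx /= -lims.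
  apply: limr_le => //; apply: nearW => n.
  by have := at_ n x; rewrite cplx_le => /andP[].
Qed.

End BoundedMeasurable.

(** * The Baire algebra *)

(** The set where [f > 0] is the cozero set of [max(0, f)], and the cozero set of [f] is the set
    where [|f| > 0]. These sets generate the Baire sigma-algebra. *)
Definition cozero_sets (R : realType) (X : topologicalType) : set (set X) :=
  [set A | exists2 f : X -> R, continuous f & A = [set x | 0 < f x]].
Arguments cozero_sets : clear implicits.

Definition cindic {R : realType} {X : Type} (A : set X) : X -> Cplx R :=
  fun x => (\1_A x : R)%:C.

Section Indicators.
Context {R : realType} {X : Type}.
Local Notation C := (Cplx R).
Implicit Types A B : set X.

Lemma cre_cindic A x : cre (@cindic R _ A x) = (x \in A)%:R.
Proof. by rewrite /cindic /cre /= indicE. Qed.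

Lemma sqn_cindic A x : sqn (@cindic R _ A x) = (x \in A)%:R.
Proof. by rewrite sqn_real indicE; case: (_ \in _); rewrite ?expr1n ?expr0n. Qed.

Lemma cindic_in A x : A x -> @cindic R _ A x = 1.
Proof. by move=> Ax; rewrite /cindic indicE mem_set. Qed.

Lemma cindic_notin A x : ~ A x -> @cindic R _ A x = 0.
Proof. by move=> Ax; rewrite /cindic indicE memNset. Qed.

Lemma cindic0 : cindic (@set0 X) = 0 :> (X -> C).
Proof. by apply/funext => x; rewrite /cindic indic0. Qed.

Lemma cindicI A B : cindic (A `&` B) = cindic A * cindic B :> (X -> C).
Proof.
by apply/funext => x; rewrite /cindic indicI /= rmorphM.
Qed.

Lemma cindicC A : cindic (~` A) = 1 - cindic A :> (X -> C).
Proof.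
apply/funext => x; rewrite [RHS](_ : _ = 1 - cindic A x) //.
by rewrite /cindic !indicE in_setC; case: (_ \in _); rewrite ?subrr ?subr0.
Qed.

Lemma cindicU A B : cindic (A `|` B) =
  cindic A + cindic B - cindic A * cindic B :> (X -> C).
Proof.
rewrite -[A `|` B]setCK setCU cindicC cindicI !cindicC.
by rewrite mulrBl mulrBr mulrBr !mulr1 !mul1r !opprB addrA addrC; ring.
Qed.

End Indicators.

Section BaireFunctions.
Context {R : realType} {X : topologicalType}.
Local Notation C := (Cplx R).
Variable x0 : X.
Hypothesis X_compact : compact [set: X].
Implicit Types f g : X -> C.

Lemma cozero_open : <<s cozero_sets R X >> `<=` <<s @open X >>.
Proof.
apply: sub_sigma_algebra2 => A [f cf ->].
have := @open_comp _ _ f [set y | 0 < y]; apply; last exact: open_gt.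
by move=> x _; exact: cf.
Qed.

(** Compactness gives the bound. For measurability, the set where [p > a] is the positivity set of
    the continuous function [p - a]. *)
Lemma continuous_bounded_measurable :
  (continuous_functions : set (X -> C)) `<=` bounded_measurable (cozero_sets R X).
Proof.
move=> f /= cf; apply/(bounded_measurableP x0).
have cr : continuous (fun x => cre (f x)).
  by move=> x; apply: continuous_comp; [exact: cf|exact: cre_continuous].
have ci : continuous (fun x => cim (f x)).
  by move=> x; apply: continuous_comp; [exact: cf|exact: cim_continuous].
split.
  have cs : continuous (fun x => sqn (f x) : R^o).
    have -> : (fun x => sqn (f x)) = (fun x => cre (f x)) \* (fun x => cre (f x))
        \+ (fun x => cim (f x)) \* (fun x => cim (f x)).
      by apply/funext => x; rewrite /sqn !expr2.
    move=> x; apply: cvgD; apply: cvgM; by [exact: cr|exact: ci].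
  have /compact_bounded/ex_bound : compact ((fun x => sqn (f x) : R^o) @` setT).
    by apply: continuous_compact => //; exact: continuous_subspaceT.
  case; last first.
    move=> M fM; exists M => x; rewrite -[sqn _]ger0_norm ?sqn_ge0 //.
    by apply: fM; exists x.
  by apply: (globally_properfilter (a := sqn (f x0))); exists x0.
have h (p : X -> R) : continuous p ->
    measurable_fun setT (p : sigmaType x0 (cozero_sets R X) -> R).
  move=> cp; apply: (measurability _ (RGenOInfty.measurableE R)).
  move=> _ [_ [a ->] <-]; rewrite setTI; apply: sub_sigma_algebra.
  exists (fun x => p x - a).
    by move=> x; apply: cvgB; [exact: cp|exact: cvg_cst].
  by apply/seteqP; split=> x /=; rewrite in_itv /= andbT subr_gt0.
by split; exact: h.
Qed.

(** * Minimality of the Baire algebra *)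

Section Minimality.
Variable D : set (X -> C).
Hypothesis D_Cstar : Cstar_subalgebra bounded_borel_functions D.
Hypothesis D_monotone : monotone_sigma_closed bounded_borel_functions D.
Hypothesis D_continuous : continuous_functions `<=` D.

Let D_cst (c : C) : D (fun=> c).
Proof. by apply: D_continuous; exact: cst_continuous. Qed.

Let D_sub f g : D f -> D g -> D (f - g).
Proof.
move=> Df Dg; rewrite -scaleN1r.
by apply: (Cstar_add D_Cstar) => //; exact: (Cstar_scale D_Cstar).
Qed.

(** The continuous functions [min(1, n * max(0, f))] increase to the indicator of the set where
    [f > 0]; at such a point they equal 1 once [n >= 1 / f x]. *)
Let D_cozero A : cozero_sets R X A -> D (cindic A).
Proof.
move=> [f cf ->].
pose b (n : nat) x : R := Num.min 1 (n%:R * Num.max 0 (f x)).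
have b01 n x : 0 <= b n x <= 1.
  rewrite /b le_min ler01 ge_min lexx /= andbT.
  by rewrite mulr_ge0 // le_max lexx.
apply: (@monotone_sigma_closed_ccvg _ _ x0 D (fun n x => (b n x)%:C) _ 1) => //.
- exact: Cstar_sub D_Cstar.
- move=> n; apply: D_continuous => x.
  apply: (@continuous_comp _ _ _ (b n) (fun r : R => (r%:C : C))).
    apply: (@continuous_min R X (cst 1) (fun x => n%:R * Num.max 0 (f x))).
      exact: cvg_cst.
    apply: (@continuousM R X (cst n%:R) (fun x => Num.max 0 (f x))).
      exact: cvg_cst.
    apply: (@continuous_max R X (cst 0) f); first exact: cvg_cst.
    exact: cf.
  exact: real_complex_continuous.
- move=> n x; rewrite /cre /= /b le_min ge_min lexx /=.
  rewrite ge_min; apply/orP; right.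
  by rewrite ler_wpM2r ?ler_nat // le_max lexx.
- move=> x; rewrite cre_cindic; apply: cvg_near_cst.
  have [fx|fx] := ltP 0 (f x).
    rewrite mem_set //=.
    apply: filterS (nbhs_infty_ger (f x)^-1) => n /= hn.
    rewrite /b max_r ?ltW //; apply/min_idPl.
    by rewrite -ler_pdivrMr // div1r.
  apply: nearW => n; rewrite memNset /=; last by rewrite ltNge fx.
  by rewrite /cre /= /b max_l // mulr0 min_r.
Qed.

(** Complements correspond to [1 - cindic A]. A countable union is the increasing limit of finite
    unions, whose indicators are polynomials in those of the terms. *)
Let D_sigma_algebra : sigma_algebra setT [set A | D (cindic A)].
Proof.
have DC A : D (cindic A) -> D (cindic (~` A)).
  by move=> DA; rewrite cindicC; apply: D_sub => //; exact: D_cst.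
split=> [|A /= DA|A /= DA].
- by rewrite /= cindic0; exact: D_cst.
- by rewrite setTD; exact: DC.
have DU n : D (cindic (\big[setU/set0]_(i < n) A i)).
  elim: n => [|n ih]; first by rewrite big_ord0 cindic0; exact: D_cst.
  rewrite big_ord_recr cindicU /=; apply: D_sub.
    by apply: (Cstar_add D_Cstar) => //; exact: DA.
  by apply: (Cstar_mul D_Cstar) => //; exact: DA.
apply: (@monotone_sigma_closed_ccvg _ _ x0 D
  (fun n => cindic (\big[setU/set0]_(i < n) A i)) _ 1) => //.
- exact: Cstar_sub D_Cstar.
- by move=> n x; rewrite cre_cindic ler0n lern1; case: (_ \in _).
- move=> n x; rewrite !cre_cindic big_ord_recr /= ler_nat.
  by rewrite in_setU; case: (_ \in _).
- move=> x; rewrite cre_cindic; apply: cvg_near_cst.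
  have [[n _ Anx]|nA] := pselect ((\bigcup_k A k) x).
    exists n.+1 => // m nm; rewrite /= in nm; rewrite [LHS]cre_cindic.
    rewrite !mem_set //; first by exists n.
    by rewrite -bigcup_mkord; exists n.
  apply: nearW => n; rewrite [LHS]cre_cindic !memNset //.
  by rewrite -bigcup_mkord => -[k _ Akx]; apply: nA; exists k.
Qed.

Let D_indic A : <<s cozero_sets R X >> A -> D (cindic A).
Proof.
have := smallest_sub D_sigma_algebra; apply; exact: D_cozero.
Qed.

Import HBSimple HBNNSimple.

Let D_simple (h : {nnsfun sigmaType x0 (cozero_sets R X) >-> R}) :
  D (fun x => (h x)%:C).
Proof.
have [s hs] : exists s : seq R, forall x,
    h x = \sum_(y <- s) (y * \1_(h @^-1` [set y]) x).
  by eexists => x; rewrite [LHS](fimfunE h x) fsbig_finite.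
have -> : (fun x => (h x)%:C) =
    \sum_(y <- s) ((y%:C : C) *: cindic (h @^-1` [set y])) :> (X -> C).
  rewrite fct_sumE; apply/funext => x; rewrite hs rmorph_sum /=.
  by apply: eq_bigr => y _; rewrite rmorphM.
elim/big_ind: _ => [||y _]; first exact: D_cst.
  by move=> f g; exact: (Cstar_add D_Cstar).
apply: (Cstar_scale D_Cstar) => //; apply: D_indic.
by have := measurable_sfunP h (measurable_set1 y).
Qed.

(** Adding [K] makes [u] nonnegative; simple functions, bounded by [K + K], increase to [u + K], and
    the constant is subtracted afterwards. *)
Let D_real (u : X -> R) (K : R) :
  measurable_fun setT (u : sigmaType x0 (cozero_sets R X) -> R) ->
  (forall x, `|u x| <= K) -> D (fun x => (u x)%:C).
Proof.
move=> mu uK.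
pose v (x : sigmaType x0 (cozero_sets R X)) : \bar R := (u x + K)%:E.
have mv : measurable_fun setT v.
  by apply/measurable_EFinP; exact: measurable_funD.
have v0 x : (0 <= v x)%E.
  by rewrite /v lee_fin; have := uK x; rewrite ler_norml => /andP[h _]; lra.
pose a := nnsfun_approx measurableT mv.
have acv x : a n x @[n --> \oo] --> u x + K.
  have := @cvg_nnsfun_approx _ _ _ _ measurableT _ mv (fun x _ => v0 x) x I.
  by move=> /fine_cvgP[].
have nda x : nondecreasing_seq (fun n => a n x).
  move=> m n mn.
  by have /lefP := @nd_nnsfun_approx _ _ _ _ measurableT _ mv _ _ mn; apply.
have aub n x : a n x <= u x + K.
  rewrite -(cvg_lim (@Rhausdorff R) (acv x)).
  by apply: nondecreasing_cvgn_le => //; apply/cvg_ex; exists (u x + K).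
have Dv : D (fun x => (u x + K)%:C).
  apply: (@monotone_sigma_closed_ccvg _ _ x0 D
    (fun n x => (a n x)%:C) _ (K + K)) => //.
  - exact: Cstar_sub D_Cstar.
  - move=> n x; rewrite /cre /= fun_ge0 /=; apply: le_trans (aub n x) _.
    by have := uK x; rewrite ler_norml => /andP[_ h]; lra.
  - by move=> n x; rewrite /cre /=; exact: nda.
have -> : (fun x => (u x)%:C) = (fun x => (u x + K)%:C) - (fun=> K%:C) :> (X -> C).
  apply/funext => x; rewrite [RHS](_ : _ = (u x + K)%:C - K%:C) //.
  by rewrite -rmorphB addrK.
by apply: D_sub => //; exact: D_cst.
Qed.

Lemma bounded_measurable_minimal : bounded_measurable (cozero_sets R X) `<=` D.
Proof.
move=> f /(bounded_measurableP x0)[[K fK] [mr mi]].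
have -> : f = (fun x => (cre (f x))%:C) + ('i%C : C) *: (fun x => (cim (f x))%:C).
  by apply/funext => x; rewrite [LHS]complexE.
(* A bound on [r] itself without square roots, from [|r| <= 1 + r ^+ 2]. *)
have ub (r : R) x : r ^+ 2 <= sqn (f x) -> `|r| <= 1 + K.
  move=> rf; have rK : r ^+ 2 <= K by exact: le_trans (fK x).
  by rewrite ler_norml; apply/andP; split; nra.
apply: (Cstar_add D_Cstar) => //; last apply: (Cstar_scale D_Cstar) => //.
  apply: (@D_real _ (1 + K)) => // x.
  by apply: (ub _ x); rewrite /sqn lerDl sqr_ge0.
apply: (@D_real _ (1 + K)) => // x.
by apply: (ub _ x); rewrite /sqn lerDr sqr_ge0.
Qed.

End Minimality.

(** The Baire functions form one of the algebras over which the intersection is taken, and every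
    such algebra contains them. *)
Lemma monotone_sigma_completionE :
  monotone_sigma_completion bounded_borel_functions continuous_functions =
  (bounded_measurable (cozero_sets R X) : set (X -> C)).
Proof.
apply/seteqP; split.
  apply: smallest_sub; last exact: continuous_bounded_measurable.
  split; first exact: (bounded_measurable_Cstar x0 cozero_open).
  exact: (bounded_measurable_monotone x0 cozero_open).
by move=> f mf D [[D1 D2] D3]; exact: bounded_measurable_minimal mf.
Qed.

End BaireFunctions.

(** * Strong operator topology *)

Section RealNorm.
Context {R : realType} {H : completeNormedModType (Cplx R)}.
Local Notation C := (Cplx R).
Implicit Types (u v w : H) (S T : H -> H).

(* The norm of H takes its values in the complex numbers. *)
Definition rnorm u : R := cre `|u|.

Lemma rnormE u : `|u| = (rnorm u)%:C.
Proof.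
have := normr_ge0 u; rewrite cplx_le => /andP[/eqP h _].
exact: cplx_eq.
Qed.

Lemma rnorm_ge0 u : 0 <= rnorm u.
Proof. by have := normr_ge0 u; rewrite cplx_le => /andP[]. Qed.

Lemma rnorm0 : rnorm 0 = 0.
Proof. by rewrite /rnorm normr0. Qed.

Lemma rnorm0_eq0 u : rnorm u = 0 -> u = 0.
Proof. by move=> u0; apply/normr0_eq0; rewrite rnormE u0. Qed.

Lemma rnormD u v : rnorm (u + v) <= rnorm u + rnorm v.
Proof. by have := ler_normD u v; rewrite !rnormE -rmorphD lecR. Qed.

Lemma rnormN u : rnorm (- u) = rnorm u.
Proof. by rewrite /rnorm normrN. Qed.

Lemma rnormB u v : rnorm (u - v) = rnorm (v - u).
Proof. by rewrite -rnormN opprB. Qed.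

Lemma rnorm_distD w u v : rnorm (u - v) <= rnorm (u - w) + rnorm (w - v).
Proof. by rewrite -[u - v](subrKA w); exact: rnormD. Qed.

(** Norm convergence in [H], phrased through a real sequence so that squeezing and limits in [R]
    apply. *)
Definition hcvg (v : nat -> H) (w : H) : Prop :=
  rnorm (v n - w) @[n --> \oo] --> (0 : R).

Lemma hcvg_le (e : nat -> R) (v : nat -> H) w :
  (\forall n \near \oo, rnorm (v n - w) <= e n) -> e n @[n --> \oo] --> 0 ->
  hcvg v w.
Proof.
move=> ve e0; apply: (squeeze_cvgr _ (@cvg_cst _ (0 : R) _ _ _) e0).
by apply: filterS ve => n ve; rewrite rnorm_ge0 ve.
Qed.

Lemma hcvg_unique (v : nat -> H) w w' : hcvg v w -> hcvg v w' -> w = w'.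
Proof.
move=> vw vw'; apply/eqP; rewrite -subr_eq0; apply/eqP/rnorm0_eq0.
apply/eqP; rewrite eq_le rnorm_ge0 andbT.
have cv : rnorm (v n - w) + rnorm (v n - w') @[n --> \oo] --> (0 : R).
  by rewrite -[0]addr0; exact: cvgD.
rewrite -(cvg_lim (@Rhausdorff R) cv).
apply: limr_ge; first by apply/cvg_ex; exists 0.
by apply: nearW => n; rewrite (rnormB (v n) w); exact: rnorm_distD.
Qed.

Lemma bounded_operators_rnorm T : bounded_operators T ->
  exists2 K : R, 0 <= K & forall u, rnorm (T u) <= K * rnorm u.
Proof.
move=> [_ [K TK]]; exists (Num.max 0 (cre K)); first by rewrite le_max lexx.
move=> u; have := TK u; rewrite !rnormE cplx_le => /andP[_].
rewrite creM /cim [X in _ - _ * X]/= mulr0 subr0 => /le_trans; apply.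
by apply: ler_wpM2r; rewrite ?rnorm_ge0 // le_max lexx orbT.
Qed.

Lemma bounded_operatorsB T u v : bounded_operators T -> T (u - v) = T u - T v.
Proof.
by move=> [lT _]; rewrite addrC -[- v]scaleN1r lT scaleN1r addrC.
Qed.

Lemma bounded_operators_comp S T : bounded_operators S -> bounded_operators T ->
  bounded_operators (S \o T).
Proof.
move=> bS bT; split; first by move=> a u v /=; rewrite bT.1 bS.1.
have [K K0 SK] := bounded_operators_rnorm bS.
have [L L0 TL] := bounded_operators_rnorm bT.
exists (K * L)%:C => u; rewrite !rnormE -rmorphM lecR -mulrA.
by apply: le_trans (SK _) _; rewrite ler_wpM2l.
Qed.

Lemma hcvg_bounded_operators T (v : nat -> H) w : bounded_operators T ->
  hcvg v w -> hcvg (T \o v) (T w).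
Proof.
move=> bT vw; have [K K0 TK] := bounded_operators_rnorm bT.
apply: (@hcvg_le (fun n => K * rnorm (v n - w))).
  by apply: nearW => n /=; rewrite -(bounded_operatorsB _ _ bT).
by rewrite -(mulr0 K); apply: cvgM => //; exact: cvg_cst.
Qed.

Lemma dense_rnorm (D : set H) u (e : R) : dense D -> 0 < e ->
  exists2 w, D w & rnorm (w - u) < e.
Proof.
move=> dD e0; have eC : (0 : C) < e%:C by rewrite cplx_lt /= eqxx.
have [] := dD (ball u (e%:C : C))°.
- by exists u; rewrite /interior; exact: nbhsx_ballx.
- exact: open_interior.
move=> w [/nbhs_singleton]; rewrite -ball_normE /ball_ /= => uw Dw; exists w => //.
by move: uw; rewrite rnormE rnormB cplx_lt => /andP[].
Qed.

Lemma bounded_operators_dense_eq (D : set H) S T : dense D ->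
  bounded_operators S -> bounded_operators T ->
  (forall w, D w -> S w = T w) -> S = T.
Proof.
move=> dD bS bT ST; apply/funext => u.
have /choice[w hw] (n : nat) : exists w, D w /\ rnorm (w - u) <= n.+1%:R^-1.
  have [w Dw wu] := @dense_rnorm D u n.+1%:R^-1 dD ltac:(by []).
  by exists w; split => //; exact: ltW.
have wu : hcvg w u.
  apply: (@hcvg_le (fun n => n.+1%:R^-1)); last exact: cvg_harmonic.
  by apply: nearW => n; exact: (hw n).2.
apply: (hcvg_unique (hcvg_bounded_operators bS wu)).
have -> : S \o w = T \o w by apply/funext => n; exact: ST (hw n).1.
exact: hcvg_bounded_operators.
Qed.

(** Basic neighbourhoods for pointwise convergence control finitely many vectors, here the list [s];
    they are built by intersecting along [s]. *)
Lemma closure_strongP (A : set (H -> H)) T :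
  closure (A : set {ptws H -> H}) T -> forall (s : seq H) (e : R), 0 < e ->
  exists2 S, A S & forall u, u \in s -> rnorm (S u - T u) < e.
Proof.
move=> cT s e e0; have eC : (0 : C) < e%:C by rewrite cplx_lt /= eqxx.
have [|S [AS ST]] := cT [set S | forall u, u \in s -> ball (T u) (e%:C : C) (S u)].
  pose F : set_system (H -> H) := nbhs (T : {ptws H -> H}).
  have FF : Filter F by exact: (nbhs_filter (T : {ptws H -> H})).
  have FT u : F [set S | ball (T u) (e%:C : C) (S u)].
    have := @proj_continuous H (fun=> H) u T; apply.
    exact: nbhsx_ballx.
  rewrite -/F; elim: s => [|v s ih]; first exact: (@filterE _ F).
  apply: filterS (filterI (FT v) ih) => S [/= Sv Ss] u.
  by rewrite in_cons => /orP[/eqP ->//|]; exact: Ss.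
exists S => // u /ST; rewrite -ball_normE /ball_ /=.
by rewrite rnormE rnormB cplx_lt => /andP[].
Qed.

(** The topology of [{ptws H -> H}] is the supremum of those induced by the evaluations, so
    convergence is checked one vector at a time. *)
Lemma hcvg_closure_strong (A : set (H -> H)) (S : nat -> H -> H) T :
  (forall n, A (S n)) -> (forall u, hcvg (S^~ u) (T u)) ->
  closure (A : set {ptws H -> H}) T.
Proof.
move=> AS ST.
(* The criterion for an induced topology asks for a surjective map; constant maps make each
   evaluation surjective. *)
have surj u : [set f u | f in [set: H -> H]] = [set: H].
  by apply/seteqP; split=> // v _; exists (cst v).
have cv : (S n : {ptws H -> H}) @[n --> \oo] --> (T : {ptws H -> H}).
  apply/cvg_sup => u; apply/cvg_image; first exact: surj.
  move=> W Wu; exists ((fun f : H -> H => f u) @^-1` W).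
    have /nbhs_ballP[e /= e0 eW] := Wu.
    have e1 : 0 < cre e by move: e0; rewrite cplx_lt => /andP[].
    have /cvgr0_norm_lt/(_ _ e1) : rnorm (S n u - T u) @[n --> \oo] --> (0 : R).
      exact: ST.
    apply: filterS => n.
    rewrite ger0_norm ?rnorm_ge0 // => h; apply: eW.
    rewrite -ball_normE /ball_ /= rnormE rnormB cplx_lt h andbT.
    by move: e0; rewrite cplx_lt => /andP[].
  by rewrite image_preimage.
move=> B /cv [N _ NB]; exists (S N); split; [exact: AS|exact: (NB N (leqnn N))].
Qed.

End RealNorm.

(** * Borel functional calculus *)

Section BorelRepresentation.
Context {R : realType} {X : topologicalType}
  {H : completeNormedModType (Cplx R)}.
Local Notation C := (Cplx R).
Variables (dot : {dot H for Num.conj}).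
Hypothesis dot_norm : forall u : H, dot u u = `|u| ^+ 2.
Variables (pi piB : (X -> C) -> H -> H).
Hypothesis piB_ext : canonical_extension dot pi piB.
Variable x0 : X.
Implicit Types (f g : X -> C) (u v : H).

Local Notation B := (bounded_borel_functions : set (X -> C)).

Let repB := ext_rep piB_ext.

Let B_bounded f : B f ->
  (exists K : R, forall x, sqn (f x) <= K) /\ cmeasurable (f : borelType x0 -> C).
Proof. by move/(bounded_measurableP x0 (@open X)). Qed.

Let BN f : B f -> B (- f).
Proof.
by move=> Bf; rewrite -scaleN1r; exact: (bounded_measurableZ x0 (G := @open X)).
Qed.

Let BB f g : B f -> B g -> B (f - g).
Proof.
by move=> Bf Bg; apply: (bounded_measurableD x0 (G := @open X)) => //; exact: BN.
Qed.

Lemma sqn_integrable (mu : {finite_measure set (borelType x0) -> \bar R}) f :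
  B f -> mu.-integrable setT (fun x => (sqn (f x))%:E).
Proof.
move=> /B_bounded[[K fK] mf]; apply: measurable_bounded_integrable => //.
- by rewrite ltey_eq fin_num_measure.
- exact: cmeasurable_sqn.
- exists K; split; first exact: num_real.
  move=> M KM x _ /=; rewrite ger0_norm ?sqn_ge0 //.
  exact: le_trans (fK x) (ltW KM).
Qed.

(** The squared norm of [piB f u] is the dot product of [piB (fun_conj f * f) u] with [u]. A single
    measure serves all [f], so a Baire set is null for it exactly when its spectral projection kills
    [u]. *)
Lemma rep_rnorm_integral u :
  exists mu : {finite_measure set (borelType x0) -> \bar R}, forall f, B f ->
    ((rnorm (piB f u)) ^+ 2)%:E = (\int[mu]_x (sqn (f x))%:E)%E.
Proof.
have [mu [_ _ mu_int]] := ext_integral piB_ext x0 u.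
exists mu => f Bf.
have Bc : B (fun_conj f) by exact: (bounded_measurable_conj x0 (G := @open X)).
have Bm : B (fun_conj f * f).
  exact: (bounded_measurableM x0 (G := @open X)).
have := mu_int _ Bm.
have cc : fun_conj (fun_conj f) = f.
  by apply/funext => x; rewrite /fun_conj conjCK.
rewrite (rep_mul repB) //= (rep_conj repB Bc) cc dot_norm rnormE -rmorphXn.
rewrite /complex_integral => -[-> _].
have -> : (fun x => complex.Re ((fun_conj f * f) x)) = (fun x => sqn (f x)).
  apply/funext => x.
  by rewrite [(fun_conj f * f) x](_ : _ = Num.conj (f x) * f x) // conj_mulE.
rewrite /Rintegral fineK //.
by apply: integrable_fin_num => //; exact: sqn_integrable.
Qed.

Lemma repB_sub f g u : B f -> B g -> piB (f - g) u = piB f u - piB g u.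
Proof.
move=> Bf Bg; rewrite (rep_add repB) //; last exact: BN.
rewrite -scaleN1r (rep_scale repB) //.
by rewrite [LHS](_ : _ = piB f u + -1 *: piB g u) // scaleN1r.
Qed.

(** Dominated convergence for the squared modulus of [a n - f]. The majorant [2 * (K + L)], with [L]
    a bound for [sqn (f x)], comes from [sqnD_le]. *)
Lemma rep_hcvg (a : nat -> X -> C) f (K : R) u :
  (forall n, B (a n)) -> B f -> (forall n x, sqn (a n x) <= K) ->
  (forall x, ccvg (a^~ x) (f x)) -> hcvg (fun n => piB (a n) u) (piB f u).
Proof.
move=> Ba Bf aK af; have [mu mu_int] := rep_rnorm_integral u.
have [[L fL] mf] := B_bounded Bf.
have Bd n : B (a n - f) by exact: BB.
have dE n x : (a n - f) x = a n x - f x by [].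
have dc : (\int[mu]_x (sqn ((a n - f) x))%:E)%E @[n --> \oo] --> 0%E.
  have [] := @dominated_convergence _ _ _ mu setT measurableT
    (fun n x => (sqn ((a n - f) x))%:E) (cst 0%E) (cst (2 * (K + L))%:E).
  - by move=> n; apply/measurable_EFinP/cmeasurable_sqn; have [] := B_bounded (Bd n).
  - exact: measurable_cst.
  - apply: aeW => x _; apply: cvg_EFin; first exact: nearW.
    exact: (ccvg_sqn (af x)).
  - exact: finite_measure_integrable_cst.
  - apply: aeW => x n _; rewrite gee0_abs ?lee_fin ?sqn_ge0 // dE.
    apply: le_trans (sqnD_le _ _) _.
    by rewrite ler_pM2l // sqnN lerD.
  - by move=> _ _; rewrite integral0.
have cv0 : (fun n => (rnorm (piB (a n) u - piB f u)) ^+ 2) @ \oo --> (0 : R).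
  have -> : (fun n => (rnorm (piB (a n) u - piB f u)) ^+ 2) =
      fine \o (fun n => \int[mu]_x (sqn ((a n - f) x))%:E)%E.
    by apply/funext => n; rewrite /= -mu_int // repB_sub.
  by have /fine_cvgP[] := dc.
rewrite /hcvg.
have -> : (fun n => rnorm (piB (a n) u - piB f u)) =
    Num.sqrt \o (fun n => (rnorm (piB (a n) u - piB f u)) ^+ 2).
  by apply/funext => n /=; rewrite sqrtr_sqr ger0_norm ?rnorm_ge0.
by rewrite -[X in _ --> X]sqrtr0; apply: continuous_cvg => //; exact: sqrt_continuous.
Qed.

End BorelRepresentation.

(** * Sequences with summable weighted increments *)

Section FastSequences.
Context {R : realType}.
Local Notation C := (Cplx R).

(** The first [k] terms, carried by [b], have a finite sum; the geometric majorant adds at most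
    [c]. *)
Lemma nneseries_geometric_lty (a : nat -> R) (k : nat) (c : R) :
  (forall n, 0 <= a n) -> 0 <= c ->
  (forall n, (k <= n)%N -> a n <= c / (2 ^ n.+1)%:R) ->
  (\sum_(n <oo) (a n)%:E < +oo)%E.
Proof.
move=> a0 c0 ac.
pose b n := if (n < k)%N then a n else 0.
have b0 n : (0 <= (b n)%:E)%E by rewrite lee_fin /b; case: ifP.
apply: (@le_lt_trans _ _ (\sum_(n <oo) ((b n)%:E + (c / (2 ^ n.+1)%:R)%:E))%E).
  apply: lee_nneseries => [n _ _|n _]; first by rewrite lee_fin.
  rewrite -EFinD lee_fin /b; case: ltnP => [_|kn].
    by rewrite lerDl divr_ge0.
  by rewrite add0r ac.
apply: le_lt_trans (epsilon_trick xpredT b0 c0) _.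
rewrite lte_add_pinfty ?ltry // (nneseries_split 0 k) // add0n.
rewrite (@eseries0 _ _ k) ?adde0 => [|n kn _]; first by rewrite sumEFin ltry.
by rewrite /b ltnNge kn.
Qed.

(* AM-GM, 2 t <= 2^n t^2 + 2^-n, bounds the sum of the increments of u. *)
Lemma fast_ccvg (u : nat -> C) :
  (\sum_(n <oo) (2 ^+ n * sqn (u n.+1 - u n))%:E < +oo)%E ->
  exists z, ccvg u z.
Proof.
move=> uoo.
have u0 n : (0 <= (2 ^+ n * sqn (u n.+1 - u n))%:E)%E.
  by rewrite lee_fin mulr_ge0 ?sqn_ge0 // exprn_ge0.
have [M uM] : exists M : R, forall n,
    \sum_(0 <= i < n) 2 ^+ i * sqn (u i.+1 - u i) <= M.
  exists (fine (\sum_(n <oo) (2 ^+ n * sqn (u n.+1 - u n))%:E)%E) => n.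
  rewrite -lee_fin -sumEFin fineK; first exact: nneseries_lim_ge.
  by rewrite ge0_fin_numE // nneseries_ge0.
have geo n : \sum_(0 <= i < n) (2^-1 : R) ^+ i <= 2.
  suff : \sum_(0 <= i < n) (2^-1 : R) ^+ i = 2 - 2 * 2^-1 ^+ n.
    by move=> ->; rewrite gerBl mulr_ge0 // exprn_ge0 // invr_ge0.
  elim: n => [|n ih]; first by rewrite big_geq // expr0; lra.
  rewrite big_nat_recr //= ih exprS; lra.
have main (p : C -> R) : (forall w, p w ^+ 2 <= sqn w) ->
    (forall w w', p (w - w') = p w - p w') -> cvgn (fun n => p (u n)).
  move=> ps pB.
  (* Each coordinate is recovered from the telescoping series of its increments, which converges
     absolutely. *)
  pose d : nat -> R := telescope (fun n => p (u n)).
  have cvd : cvgn (series d).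
    apply: normed_cvg; apply: nondecreasing_is_cvgn.
      apply/nondecreasing_seqP => n.
      rewrite [leRHS](_ : _ = \sum_(0 <= i < n) `|d i| + `|d n|) ?lerDl //.
      exact: big_nat_recr.
    (* Here [M] bounds the sum of weighted squares and 2 bounds the geometric sum. *)
    exists ((M + 2) / 2) => _ [n _ <-].
    apply: (@le_trans _ _ (\sum_(0 <= i < n)
      (2 ^+ i * sqn (u i.+1 - u i) + 2^-1 ^+ i) / 2)).
      apply: ler_sum => i _.
      rewrite [leLHS](_ : _ = `|p (u i.+1 - u i)|); last by rewrite pB.
      have := ps (u i.+1 - u i); rewrite -[p _ ^+ 2]real_normK ?num_real //.
      move: (sqn _) => s; have := normr_ge0 (p (u i.+1 - u i)).
      move: `|p _| => t t0 ts.
      rewrite ler_pdivlMr // exprVn.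
      have e0 : 0 < 2 ^+ i :> R by rewrite exprn_gt0.
      apply: (@le_trans _ _ (2 ^+ i * t ^+ 2 + (2 ^+ i)^-1)).
        rewrite -subr_ge0.
        have -> : 2 ^+ i * t ^+ 2 + (2 ^+ i)^-1 - t * 2 =
            (2 ^+ i)^-1 * (2 ^+ i * t - 1) ^+ 2.
          by field; rewrite gt_eqF.
        by rewrite mulr_ge0 ?sqr_ge0 // invr_ge0 ltW.
      by rewrite lerD2r ler_wpM2l // ltW.
    rewrite -mulr_suml ler_pM2r // big_split /=; exact: lerD.
  move: cvd => /cvg_ex[/= l dl]; apply/cvg_ex; exists (l + p (u 0%N)).
  have -> : (fun n => p (u n)) = (fun n => series d n + p (u 0%N)).
    by apply/funext => n; rewrite telescopeK /= subrK.
  by apply: cvgD => //; exact: cvg_cst.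
have cr := main cre; have ci := main cim.
exists (limn (fun n => cre (u n)) +i* limn (fun n => cim (u n))); split.
  apply: cr => [w|w w']; first by rewrite /sqn lerDl sqr_ge0.
  by rewrite creD creN.
apply: ci => [w|w w']; first by rewrite /sqn lerDr sqr_ge0.
by rewrite cimD cimN.
Qed.

Lemma ccvg_bounded (u : nat -> C) z : ccvg u z ->
  exists K : R, forall n, sqn (u n) <= K.
Proof.
have bnd (v : nat -> R) (l : R) : v n @[n --> \oo] --> l -> exists K, forall n, `|v n| <= K.
  move=> vl; have cv : cvgn v by apply/cvg_ex; exists l.
  have [K [_ vK]] := cvg_seq_bounded cv; exists (K + 1) => n.
  by apply: vK => //; rewrite ltrDl.
move=> [/bnd[K uK] /bnd[L uL]].
exists (K ^+ 2 + L ^+ 2) => n; rewrite /sqn.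
have sq (t r : R) : `|t| <= r -> t ^+ 2 <= r ^+ 2.
  by move=> tr; rewrite -real_normK ?num_real // ler_pXn2r ?nnegrE // (le_trans _ tr).
by apply: lerD; apply: sq; [exact: uK|exact: uL].
Qed.

Lemma ccvg_sqn_le (u : nat -> C) z (K : R) : ccvg u z ->
  (forall n, sqn (u n) <= K) -> sqn z <= K.
Proof.
move=> [ur ui] uK.
have cv : sqn (u n) @[n --> \oo] --> sqn z.
  rewrite /sqn; apply: cvgD; rewrite !expr2; under eq_fun do rewrite expr2;
  exact: cvgM.
rewrite -(cvg_lim (@Rhausdorff R) cv); apply: limr_le; last exact: nearW.
by apply/cvg_ex; exists (sqn z).
Qed.

Lemma ccvg_cst (z : C) : ccvg (fun=> z) z.
Proof. by split; exact: cvg_cst. Qed.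

Lemma ccvgM (u v : nat -> C) z w : ccvg u z -> ccvg v w ->
  ccvg (fun n => u n * v n) (z * w).
Proof.
move=> [ur ui] [vr vi]; split.
  rewrite creM; under eq_fun do rewrite creM.
  by apply: cvgB; exact: cvgM.
rewrite cimM; under eq_fun do rewrite cimM.
by apply: cvgD; exact: cvgM.
Qed.

Lemma ccvg_near_eq (u : nat -> C) z : (\forall n \near \oo, u n = z) -> ccvg u z.
Proof.
by move=> uz; split; apply: cvg_near_cst; apply: filterS uz => n ->.
Qed.

End FastSequences.

(** * Operators in the strong closure of the image of the Baire algebra *)

Section StrongClosure.
Context {R : realType} {X : topologicalType}
  {H : completeNormedModType (Cplx R)}.
Local Notation C := (Cplx R).
Variables (dot : {dot H for Num.conj}).
Hypothesis dot_norm : forall u : H, dot u u = `|u| ^+ 2.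
Variables (pi piB : (X -> C) -> H -> H).
Hypothesis piB_ext : canonical_extension dot pi piB.
Variable x0 : X.
Implicit Types (f g : X -> C) (u v : H) (A E : set X).

Local Notation B := (bounded_borel_functions : set (X -> C)).
Local Notation baire := (bounded_measurable (cozero_sets R X) : set (X -> C)).
Local Notation baireT := (sigmaType x0 (cozero_sets R X)).
Local Notation P A := (piB (cindic A)).

Let repB := ext_rep piB_ext.

Let baireB : baire `<=` B := bounded_measurable_sub cozero_open.

Let baire_indic A : measurable (A : set baireT) -> baire (cindic A).
Proof.
move=> mA; apply/(bounded_measurableP x0); split.
  by exists 1 => x; rewrite sqn_cindic lern1; case: (_ \in _).
by split; [exact: measurable_indic|exact: measurable_cst].
Qed.

Let baireM f g : baire f -> baire g -> baire (f * g).
Proof. exact: bounded_measurableM x0 _ _ _. Qed.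

Let baire_sub f g : baire f -> baire g -> baire (f - g).
Proof.
move=> bf bg; apply: (bounded_measurableD x0) => //.
by rewrite -scaleN1r; exact: (bounded_measurableZ x0).
Qed.

Let repM f g u : baire f -> baire g -> piB (f * g) u = piB f (piB g u).
Proof. by move=> bf bg; rewrite (rep_mul repB) //; exact: baireB. Qed.

Let rep_bop f : baire f -> bounded_operators (piB f).
Proof. by move=> bf; apply: (rep_bounded repB); exact: baireB. Qed.

Let repB_subE f g u : baire f -> baire g ->
  piB (f - g) u = piB f u - piB g u.
Proof.
by move=> bf bg; apply: (repB_sub piB_ext x0); exact: baireB.
Qed.

Let baire_hcvg (a : nat -> X -> C) f (K : R) u :
  (forall n, baire (a n)) -> baire f -> (forall n x, sqn (a n x) <= K) ->
  (forall x, ccvg (a^~ x) (f x)) -> hcvg (fun n => piB (a n) u) (piB f u).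
Proof.
move=> ba bf aK af; apply: (rep_hcvg dot_norm piB_ext x0 (K := K)) => //.
  by move=> n; exact: baireB.
exact: baireB.
Qed.

Variable T : H -> H.
Hypothesis T_bounded : bounded_operators T.
Hypothesis T_closure : closure (piB @` baire : set {ptws H -> H}) T.

(** The function [f n] is chosen for the finitely many vectors [xi 0, ..., xi n], so each vector is
    controlled from its own index on. *)
Let T_approx (xi : nat -> H) : exists f : nat -> X -> C,
  (forall n, baire (f n)) /\ forall n k, (k <= n)%N ->
    rnorm (piB (f n) (xi k) - T (xi k)) <= 2^-1 ^+ n.
Proof.
have /choice[f hf] (n : nat) : exists f, baire f /\ forall k, (k <= n)%N ->
    rnorm (piB f (xi k) - T (xi k)) <= 2^-1 ^+ n.
  have e0 : 0 < (2^-1 : R) ^+ n by rewrite exprn_gt0 // invr_gt0.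
  have [_ [f bf <-] fT] := closure_strongP T_closure (map xi (iota 0 n.+1)) e0.
  exists f; split => // k kn; apply/ltW/fT; apply: map_f.
  by rewrite mem_iota add0n ltnS.
by exists f; split=> [n|n]; [exact: (hf n).1|exact: (hf n).2].
Qed.

Let half_cvg0 : (2^-1 : R) ^+ n @[n --> \oo] --> (0 : R).
Proof. by apply: cvg_expr; rewrite ger0_norm ?invr_ge0 // invf_lt1 // ltr1n. Qed.

(** The operators [piB (f n)] approximating [T] commute with [piB g], and [piB g] is continuous. *)
Let T_commutes g u : baire g -> T (piB g u) = piB g (T u).
Proof.
move=> bg.
(* With the sequence [u, piB g u, piB g u, ...] the same [f] serves both vectors; the second is
   controlled from [n = 1] on. *)
have [f [bf fT]] := T_approx (fun k => if k is 0 then u else piB g u).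
have cv1 : hcvg (fun n => piB (f n) (piB g u)) (T (piB g u)).
  by apply: (hcvg_le _ half_cvg0); exists 1%N => // n; exact: (fT n 1%N).
have cv0 : hcvg (fun n => piB (f n) u) (T u).
  by apply: (hcvg_le _ half_cvg0); apply: nearW => n; exact: (fT n 0%N).
apply: (hcvg_unique cv1).
have -> : (fun n => piB (f n) (piB g u)) = piB g \o (fun n => piB (f n) u).
  by apply/funext => n /=; rewrite -!repM // mulrC.
by apply: hcvg_bounded_operators => //; exact: rep_bop.
Qed.

Section DenseSequence.
Variables (xi : nat -> H) (f : nat -> X -> C).
Hypothesis xi_dense : dense (range xi).
Hypothesis f_baire : forall n, baire (f n).
Hypothesis f_approx : forall n k, (k <= n)%N ->
  rnorm (piB (f n) (xi k) - T (xi k)) <= 2^-1 ^+ n.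

(** The weight [2 ^+ n] suffices for [fast_ccvg] and is still beaten by the squared approximation
    error, of order [4 ^- n]. *)
Let h (n : nat) (x : X) : R := 2 ^+ n * sqn (f n.+1 x - f n x).

Let E : set X := [set x | (\sum_(n <oo) (h n x)%:E < +oo)%E].

Let h_ge0 n x : 0 <= h n x.
Proof. by rewrite mulr_ge0 ?sqn_ge0 // exprn_ge0. Qed.

Let sum_ge0 x : (0 <= \sum_(n <oo) (h n x)%:E)%E.
Proof. by apply: nneseries_ge0 => n _ _; rewrite lee_fin. Qed.

Let bd n : baire (f n.+1 - f n).
Proof. exact: baire_sub. Qed.

(** Stated for a general [G]: cozero sets are needed to make [E] a Baire set, open sets to integrate
    against Borel measures. *)
Let h_measurable (G : set (set X)) n : bounded_measurable G (f n.+1 - f n) ->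
  measurable_fun setT (h n : sigmaType x0 G -> R).
Proof.
move=> /(bounded_measurableP x0)[_ /cmeasurable_sqn m].
by apply: measurable_funM => //; exact: measurable_cst.
Qed.

Let sum_measurable (G : set (set X)) :
  (forall n, bounded_measurable G (f n.+1 - f n)) ->
  measurable_fun setT
    ((fun x => \sum_(n <oo) (h n x)%:E)%E : sigmaType x0 G -> \bar R).
Proof.
move=> mG; apply: ge0_emeasurable_sum.
  by move=> n x _ _; rewrite lee_fin.
by move=> n _; apply/measurable_EFinP; exact: h_measurable.
Qed.

Let E_measurable : measurable (E : set baireT).
Proof.
have := emeasurable_fun_infty_o measurableT (sum_measurable bd) +oo%E.
by rewrite setTI.
Qed.

Let E_full k : P E (xi k) = xi k.
Proof.
have mE : measurable (~` E : set baireT) by exact: measurableC.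
suff E0 : P (~` E) (xi k) = 0.
  rewrite -[E]setCK cindicC repB_subE ?E0 ?subr0 ?(rep_one repB) //.
    exact: (bounded_measurable_cst x0).
  exact: baire_indic.
have [mu mu_int] := rep_rnorm_integral dot_norm piB_ext x0 (xi k).
have bdB n : bounded_measurable (@open X) (f n.+1 - f n) by exact: baireB.
have mEB : measurable (~` E : set (borelType x0)).
  exact: cozero_open mE.
have int_h n : (\int[mu]_x (h n x)%:E =
    (2 ^+ n * rnorm (piB (f n.+1 - f n) (xi k)) ^+ 2)%:E)%E.
  rewrite EFinM mu_int; last exact: baireB.
  rewrite -ge0_integralZl_EFin //.
  - by move=> x _; rewrite lee_fin sqn_ge0.
  - have /(bounded_measurableP x0)[_ /cmeasurable_sqn m] := bdB n.
    exact/measurable_EFinP.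
have sum_lty : (\int[mu]_x \sum_(n <oo) (h n x)%:E < +oo)%E.
  rewrite integral_nneseries //; first last.
  - by move=> n x _; rewrite lee_fin.
  - by move=> n; apply/measurable_EFinP; exact: h_measurable.
  rewrite (eq_eseriesr (fun n _ => int_h n)).
  (* For [n >= k] the increment has norm at most [2 * 2^-1 ^+ n]; its square times [2 ^+ n] is
     [4 / 2 ^+ n], that is [8 / 2 ^+ n.+1]. *)
  apply: (@nneseries_geometric_lty _ _ k 8) => // n.
    by rewrite mulr_ge0 ?sqr_ge0 // exprn_ge0.
  move=> kn; rewrite repB_subE //.
  have : rnorm (piB (f n.+1) (xi k) - piB (f n) (xi k)) <= 2 * 2^-1 ^+ n.
    apply: le_trans (rnorm_distD (T (xi k)) _ _) _.
    rewrite (rnormB (T _)) mulr_natl mulr2n lerD ?f_approx //.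
    apply: le_trans (f_approx (leqW kn)) _.
    rewrite exprS ger_pMl ?exprn_gt0 ?invr_gt0 //; lra.
  have := rnorm_ge0 (piB (f n.+1) (xi k) - piB (f n) (xi k)).
  move: (rnorm _) => t t0 tn.
  have e0 : 0 < (2 : R) ^+ n by rewrite exprn_gt0.
  rewrite natrX (exprS _ n) invfM.
  have : t ^+ 2 <= (2 * 2^-1 ^+ n) ^+ 2 by rewrite ler_pXn2r ?nnegrE // (le_trans t0).
  rewrite exprVn -(ler_pM2l e0) => /le_trans; apply.
  by rewrite le_eqVlt; apply/orP; left; apply/eqP; field; rewrite gt_eqF.
have [N [mN N0 EN]] : mu.-negligible (~` E).
  have : mu.-integrable setT (fun x => \sum_(n <oo) (h n x)%:E)%E.
    apply/integrableP; split; first exact: sum_measurable.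
    under eq_integral => x _ do rewrite gee0_abs ?sum_ge0 //.
    exact: sum_lty.
  move=> /(integrable_ae measurableT); apply: negligibleS => x /= nEx.
  move=> /(_ I); by rewrite ge0_fin_numE.
apply/rnorm0_eq0/eqP; rewrite -sqrf_eq0; apply/eqP.
apply: EFin_inj; rewrite mu_int; last exact/baireB/baire_indic.
under eq_integral do rewrite sqn_cindic -indicE.
rewrite integral_indic // setIT; apply/eqP; rewrite eq_le measure_ge0 andbT.
by rewrite [leRHS](_ : _ = mu N) //; apply: le_measure => //; rewrite inE.
Qed.

Let E_cvg x : E x -> exists z, ccvg (f^~ x) z.
Proof. by move=> /fast_ccvg. Qed.

(** With the value 0 off [E], [F] is everywhere the limit of the Baire functions [f n * cindic E],
    hence measurable. It may be unbounded. *)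
Let F_ex : exists F : X -> C, [/\ cmeasurable (F : baireT -> C),
  forall x, E x -> ccvg (f^~ x) (F x) & forall x, ~ E x -> F x = 0].
Proof.
have /choice[F hF] (x : X) :
    exists z, (E x -> ccvg (f^~ x) z) /\ (~ E x -> z = 0).
  have [Ex|nEx] := pselect (E x); last by exists 0.
  by have [z fz] := E_cvg Ex; exists z.
have FE x : E x -> ccvg (f^~ x) (F x) by have [] := hF x.
have F0 x : ~ E x -> F x = 0 by have [] := hF x.
exists F; split => //.
have fF x : ccvg ((fun n => f n * cindic E)^~ x) (F x).
  have [Ex|nEx] := pselect (E x).
    rewrite -[F x]mulr1 -(cindic_in Ex).
    by apply: ccvgM; [exact: FE|exact: ccvg_cst].
  by apply: ccvg_near_eq; apply: nearW => n; rewrite F0 // fctE cindic_notin ?mulr0.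
apply: (@cmeasurable_cvg _ _ baireT (fun n => f n * cindic E)) => [n|x|x].
- have : baire (f n * cindic E) by apply: baireM => //; exact: baire_indic.
  by move=> /(bounded_measurableP x0)[].
- by have [] := fF x.
- by have [] := fF x.
Qed.

(** Uniform bounds on the [f n] are what [baire_hcvg] asks for. Since convergent sequences are
    bounded, these sets exhaust [E]. *)
Let EL (L : nat) : set X := E `&` [set x | forall n, sqn (f n x) <= L%:R].

Let sublevel_measurable (g : X -> R) (r : R) :
  measurable_fun setT (g : baireT -> R) ->
  measurable ([set x | g x <= r] : set baireT).
Proof.
move=> mg; have := mg measurableT _ (measurable_itv `]-oo, r]).
by rewrite setTI; congr measurable.
Qed.

Let EL_measurable L : measurable (EL L : set baireT).
Proof.
apply: measurableI => //.
have -> : [set x | forall n, sqn (f n x) <= L%:R] =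
    \bigcap_n [set x | sqn (f n x) <= L%:R].
  by apply/seteqP; split=> [x h0 n _|x h0 n]; [exact: h0|exact: (h0 n I)].
apply: bigcapT_measurable => n; apply: sublevel_measurable.
apply: cmeasurable_sqn.
by have /(bounded_measurableP x0)[] := f_baire n.
Qed.

Let EL_near x : E x -> \forall L \near \oo, EL L x.
Proof.
move=> Ex; have [z /ccvg_bounded[K fK]] := E_cvg Ex.
apply: filterS (nbhs_infty_ger K) => L KL; split => // n.
exact: le_trans (fK n) KL.
Qed.

Lemma rep_range_closed : exists2 g, baire g & piB g = T.
Proof.
have [F [mF FE F0]] := F_ex.
have f_cvg k : hcvg (fun n => piB (f n) (xi k)) (T (xi k)).
  by apply: (hcvg_le _ half_cvg0); exists k => // n kn; exact: f_approx.
have FL L A : A `<=` EL L -> forall x, sqn ((F * cindic A) x) <= L%:R.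
  move=> AL x; rewrite fctE sqnM sqn_cindic.
  have [Ax|nAx] := pselect (A x); last by rewrite memNset // mulr0.
  have [Ex fL] := AL _ Ax; rewrite mem_set // mulr1.
  exact: ccvg_sqn_le (FE _ Ex) fL.
have mFA A : measurable (A : set baireT) -> cmeasurable (F * cindic A : baireT -> C).
  move=> mA; apply: cmeasurableM => //.
  by have /(bounded_measurableP x0)[] := baire_indic mA.
have bFA L A : measurable (A : set baireT) -> A `<=` EL L -> baire (F * cindic A).
  move=> mA AL; apply/(bounded_measurableP x0); split; last exact: mFA.
  by exists L%:R; exact: FL.
(* The functions [f n * cindic A] are uniformly bounded and tend to [F * cindic A], while their
   operators, applied to [xi k], tend to [P A (T (xi k))], which is [T (P A (xi k))]. *)
have FT L A : measurable (A : set baireT) -> A `<=` EL L ->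
    piB (F * cindic A) = T \o P A.
  move=> mA AL; apply: (bounded_operators_dense_eq xi_dense).
  - exact/rep_bop/(bFA L).
  - by apply: bounded_operators_comp => //; exact/rep_bop/baire_indic.
  move=> _ [k _ <-] /=; rewrite T_commutes; last exact: baire_indic.
  have : hcvg (fun n => piB (f n * cindic A) (xi k)) (piB (F * cindic A) (xi k)).
    apply: (@baire_hcvg _ _ L%:R) => [n||n x|x].
    - by apply: baireM => //; exact: baire_indic.
    - exact: (bFA L).
    - rewrite fctE sqnM sqn_cindic.
      have [Ax|nAx] := pselect (A x); last by rewrite memNset // mulr0.
      by have [_ fL] := AL _ Ax; rewrite mem_set // mulr1.
    - have [Ax|nAx] := pselect (A x).
        by apply: ccvgM; [apply: FE; case: (AL _ Ax)|exact: ccvg_cst].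
      apply: ccvg_near_eq; apply: nearW => n.
      by rewrite !fctE cindic_notin // !mulr0.
  move=> /hcvg_unique; apply.
  have -> : (fun n => piB (f n * cindic A) (xi k)) =
      P A \o (fun n => piB (f n) (xi k)).
    by apply/funext => n /=; rewrite mulrC repM //; exact: baire_indic.
  by apply: hcvg_bounded_operators => //; exact/rep_bop/baire_indic.
have [K K0 TK] := bounded_operators_rnorm T_bounded.
(* Any M > K^2 would do. *)
pose M := K ^+ 2 + 1.
have M0 : 0 <= M by rewrite addr_ge0 ?sqr_ge0.
pose G := [set x | sqn (F x) <= M].
have mG : measurable (G : set baireT).
  by apply: sublevel_measurable; exact: cmeasurable_sqn.
(* On EL L the operator T is multiplication by F, so the spectral projection of
   the part where |F|^2 > M vanishes. *)
have PG0 L u : P (EL L `&` ~` G) u = 0.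
  set A := EL L `&` ~` G.
  have mA : measurable (A : set baireT).
    by apply: measurableI => //; exact: measurableC.
  have AL : A `<=` EL L by exact: subIsetl.
  have [mu mu_int] := rep_rnorm_integral dot_norm piB_ext x0 u.
  pose t := rnorm (P A u).
  (* The right side is the integral of [|F|^2] over [A], where [|F|^2 > M], and [t ^+ 2] is the
     measure of [A]. *)
  have le1 : M * t ^+ 2 <= rnorm (T (P A u)) ^+ 2.
    have -> : T (P A u) = piB (F * cindic A) u by rewrite (FT L).
    rewrite -lee_fin EFinM !mu_int; first last.
    - exact/baireB/baire_indic.
    - exact/baireB/(bFA L).
    have msq g : baire g ->
        measurable_fun setT ((fun x => (sqn (g x))%:E) : borelType x0 -> \bar R).
      move=> /baireB/(bounded_measurableP x0 (@open X))[_ /cmeasurable_sqn m].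
      exact/measurable_EFinP.
    have -> : (M%:E * \int[mu]_x (sqn (cindic A x))%:E =
        \int[mu]_x (M%:E * (sqn (cindic A x))%:E))%E.
      rewrite ge0_integralZl_EFin //.
        by move=> x _; rewrite lee_fin sqn_ge0.
      exact: (msq _ (baire_indic mA)).
    apply: ge0_le_integral => //.
    - by move=> x _; rewrite -EFinM lee_fin mulr_ge0 ?sqn_ge0.
    - by apply: measurable_funeM; exact: (msq _ (baire_indic mA)).
    - exact: (msq _ (bFA L A mA AL)).
    move=> x _; rewrite -EFinM lee_fin fctE sqnM.
    have [Ax|nAx] := pselect (A x).
      have [_ nGx] := Ax; rewrite sqn_cindic mem_set // !mulr1.
      by move/negP: nGx; rewrite -ltNge => /ltW.
    by rewrite sqn_cindic memNset // !mulr0.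
  have le2 : rnorm (T (P A u)) ^+ 2 <= K ^+ 2 * t ^+ 2.
    by rewrite -exprMn ler_pXn2r ?nnegrE ?rnorm_ge0 ?mulr_ge0 ?rnorm_ge0.
  apply/rnorm0_eq0; rewrite -/t; apply/eqP; rewrite -sqrf_eq0 eq_le sqr_ge0 andbT.
  (* From [(K ^+ 2 + 1) * t ^+ 2 <= K ^+ 2 * t ^+ 2] it follows that [t] vanishes. *)
  have := le_trans le1 le2; rewrite /M mulrDl mul1r.
  by rewrite gerDl.
have mAL L : measurable (EL L `&` G : set baireT) by exact: measurableI.
have bF : baire (F * cindic G).
  apply/(bounded_measurableP x0); split; last exact: mFA.
  exists M => x; rewrite fctE sqnM sqn_cindic.
  have [Gx|nGx] := pselect (G x); first by rewrite mem_set // mulr1.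
  by rewrite memNset // mulr0.
exists (F * cindic G) => //.
apply: (bounded_operators_dense_eq xi_dense) => //; first exact: rep_bop.
move=> _ [k _ <-].
(* The cut-offs by [EL L] converge at every point, also off [E], because [F] is 0 there. Their
   images have the second limit [T (xi k)], and limits are unique. *)
have : hcvg (fun L => piB (F * cindic (EL L `&` G)) (xi k))
    (piB (F * cindic G) (xi k)).
  apply: (@baire_hcvg _ _ M) => // [L|L x|x].
  - by apply: (bFA L) => //; exact: subIsetl.
  - rewrite fctE sqnM sqn_cindic.
    have [AGx|nGx] := pselect ((EL L `&` G) x).
      by rewrite mem_set // mulr1; case: AGx.
    by rewrite memNset // mulr0.
  - apply: ccvg_near_eq.
    have [Ex|nEx] := pselect (E x).
      apply: filterS (EL_near Ex) => L ELx; rewrite !fctE; congr (_ * _).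
      have [Gx|nGx] := pselect (G x); first by rewrite !cindic_in.
      by rewrite !cindic_notin // => -[].
    by apply: nearW => L; rewrite !fctE F0 // !mul0r.
move=> /hcvg_unique; apply.
have -> : (fun L => piB (F * cindic (EL L `&` G)) (xi k)) =
    T \o (fun L => P (EL L) (xi k)).
  apply/funext => L; rewrite (FT L _ (mAL L) (@subIsetl _ _ _)) /=.
  congr T.
  (* By [PG0], intersecting with [G] does not change the projection. *)
  have -> : cindic (EL L `&` G) = cindic (EL L) - cindic (EL L `&` ~` G) :> (X -> C).
    by rewrite !cindicI cindicC mulrBr mulr1 opprB addrC subrK.
  rewrite repB_subE ?PG0 ?subr0 //; apply: baire_indic => //.
  by apply: measurableI => //; exact: measurableC.
apply: hcvg_bounded_operators => //.
(* As [P E] fixes [xi k], it is enough that the indicators of [EL L] converge to that of [E]. *)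
rewrite -[X in hcvg _ X]E_full.
apply: (@baire_hcvg _ _ 1) => [L||L x|x]; try exact: baire_indic.
- by rewrite sqn_cindic lern1; case: (_ \in _).
- apply: ccvg_near_eq.
  have [Ex|nEx] := pselect (E x).
    by apply: filterS (EL_near Ex) => L ELx; rewrite !cindic_in.
  by apply: nearW => L; rewrite !cindic_notin // => -[].
Qed.

End DenseSequence.

Lemma rep_strong_closure : (exists D : set H, countable D /\ dense D) ->
  exists2 g, baire g & piB g = T.
Proof.
move=> [D [/countable_injP[i i_inj] dD]].
(* The injection [i] on [D] is inverted; indices outside its image get the vector 0, and the
   enlarged range is still dense. *)
have /choice[xi xiD] n : exists u, forall v, D v -> i v = n -> v = u.
  have [[u [Du iu]]|nu] := pselect (exists u, D u /\ i u = n); last first.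
    by exists 0 => v Dv iv; exfalso; apply: nu; exists v.
  by exists u => v Dv iv; apply: i_inj; rewrite ?inE ?iu.
have dxi : dense (range xi).
  move=> O O0 oO; have [u [Ou Du]] := dD O O0 oO.
  by exists u; split => //; exists (i u) => //; apply/esym/xiD.
have [f [bf fT]] := T_approx xi.
exact: rep_range_closed dxi bf fT.
Qed.

End StrongClosure.

(** * Von Neumann algebras *)

Section VonNeumann.
Context {R : realType} {X : topologicalType}
  {H : completeNormedModType (Cplx R)}.
Local Notation C := (Cplx R).
Variables (dot : {dot H for Num.conj}).
Hypothesis dot_norm : forall u : H, dot u u = `|u| ^+ 2.
Variables (pi piB : (X -> C) -> H -> H).
Hypothesis piB_ext : canonical_extension dot pi piB.
Variable x0 : X.

Local Notation B := (bounded_borel_functions : set (X -> C)).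
Local Notation baire := (bounded_measurable (cozero_sets R X) : set (X -> C)).

Let repB := ext_rep piB_ext.

(** Definiteness of [dot]. Closure under adjoints is asked for every adjoint [S], whereas the
    representation supplies one. *)
Lemma adjoint_unique (T S S' : H -> H) :
  adjoint dot T S -> adjoint dot T S' -> S = S'.
Proof.
move=> TS TS'; apply/funext => v; apply/eqP; rewrite -subr_eq0 -normr_eq0.
have : dot (S v - S' v) (S v - S' v) = 0.
  by rewrite linearBr /= -TS -TS' subrr.
by rewrite dot_norm => /eqP; rewrite sqrf_eq0.
Qed.

(** By minimality the monotone sigma-completion lies in [D] as soon as [D] contains C(X), so that
    its image lies in [N]. *)
Lemma von_neumann_preimage (N : set (H -> H)) : von_neumann_algebra dot N ->
  let D := [set f | B f /\ N (piB f)] in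
  Cstar_subalgebra B D /\ monotone_sigma_closed B D.
Proof.
move=> vN D.
have CB := bounded_measurable_Cstar (R := R) x0 (G := @open X) (fun=> id).
(* Common source of both closure properties: bounded pointwise limits become strong limits, and [N]
   is strongly closed. *)
have NB f K (a : nat -> X -> C) : B f -> (forall n, D (a n)) ->
    (forall n x, sqn (a n x) <= K) -> (forall x, ccvg (a^~ x) (f x)) ->
    N (piB f).
  move=> Bf Da aK af; apply: (vn_closed vN); split.
    exact: (rep_bounded repB).
  apply: (@hcvg_closure_strong _ _ N (fun n => piB (a n))).
    by move=> n; exact: (Da n).2.
  move=> u; apply: (rep_hcvg dot_norm piB_ext x0 (K := K)) => // n.
  exact: (Da n).1.
split; first split.
- by move=> f [].
- have B1 : B 1 by exact: (bounded_measurable_cst x0 (@open X) 1).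
  split; first exact: (Cstar_0 CB).
  (* The image of 0 is the multiple 0 of the identity. *)
  rewrite -[0](scale0r (1 : X -> C)) (rep_scale repB) // (rep_one repB).
  exact: (vn_scale vN _ (vn_id vN)).
- move=> f g [Bf Nf] [Bg Ng]; split; first exact: (Cstar_add CB).
  by rewrite (rep_add repB) //; exact: (vn_add vN).
- move=> c f [Bf Nf]; split; first exact: (Cstar_scale CB).
  by rewrite (rep_scale repB) //; exact: (vn_scale vN).
- move=> f g [Bf Nf] [Bg Ng]; split; first exact: (Cstar_mul CB).
  by rewrite (rep_mul repB) //; exact: (vn_comp vN).
- move=> f [Bf Nf]; split; first exact: (Cstar_conj CB).
  exact: (vn_adjoint vN Nf (rep_conj repB Bf)).
- move=> f [Bf] /closure_uniform_seq[g Dg [gf g1]]; split => //.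
  have /(bounded_measurableP x0 (@open X))[[K fK] _] := Bf.
  apply: (NB f (2 * (1 + K)) g) => // n x.
  rewrite -[g n x](subrK (f x)); apply: le_trans (sqnD_le _ _) _.
  by rewrite ler_pM2l // lerD.
- move=> a Da ai [K aK] s ss; have [Bs _ _ _] := ss; split => //.
  apply: (NB s (cre K ^+ 2) a) => // [n|n x|].
  + exact: (Da n).1.
  + exact/norm_le_sqn/aK.
  + apply: (supremum_ccvg x0) => // n.
    by split; [exact: (Da n).1.1|exact: (Da n).2].
Qed.

Lemma von_neumann_range : strongly_closed (piB @` baire) ->
  von_neumann_algebra dot (piB @` baire).
Proof.
move=> clM; have bB := bounded_measurable_sub (R := R) (@cozero_open R X).
have CB := bounded_measurable_Cstar (R := R) x0 (@cozero_open R X).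
split => //.
- by move=> _ [f bf <-]; apply: (rep_bounded repB); exact: bB.
- exists 1; last exact: (rep_one repB).
  exact: (bounded_measurable_cst x0).
- move=> _ _ [f bf <-] [g bg <-]; exists (f + g); first exact: (Cstar_add CB).
  by rewrite (rep_add repB) //; exact: bB.
- move=> c _ [f bf <-]; exists (c *: f); first exact: (Cstar_scale CB).
  by rewrite (rep_scale repB) //; exact: bB.
- move=> _ _ [f bf <-] [g bg <-]; exists (f * g); first exact: (Cstar_mul CB).
  by rewrite (rep_mul repB) //; exact: bB.
- move=> _ S [f bf <-] fS; exists (fun_conj f); first exact: (Cstar_conj CB).
  by apply: adjoint_unique fS; apply: (rep_conj repB); exact: bB.
Qed.

End VonNeumann.

Theorem mainTheorem2
  (R : realType)
  (X : topologicalType)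
  (X_compact : compact [set: X])
  (X_hausdorff : hausdorff_space X)
  (H : completeNormedModType (Cplx R))
  (dot : {dot H for Num.conj})
  (dot_norm : forall u : H, dot u u = `|u| ^+ 2)
  (H_separable : exists D : set H, countable D /\ dense D)
  (pi : (X -> Cplx R) -> H -> H)
  (pi_rep : unital_representation dot continuous_functions pi)
  (piB : (X -> Cplx R) -> H -> H)
  (piB_ext : canonical_extension dot pi piB) :
  let M := monotone_sigma_completion bounded_borel_functions
             continuous_functions in
  strongly_closed (piB @` M) /\
  piB @` M = generated_von_neumann_algebra dot (pi @` continuous_functions).
Proof.
move=> M.
have CM : continuous_functions `<=` M by exact: sub_gen_smallest.
have [[x0 _]|X0] := pselect (exists x : X, True); last first.
  (* For empty X the unit of C(X) is 0, so that H is zero. *)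
  have c0 : continuous_functions (0 : X -> Cplx R) by exact: cst_continuous.
  have id0 : idfun = 0 :> (H -> H).
    rewrite -(rep_one pi_rep).
    have -> : (1 : X -> Cplx R) = 0.
      by apply/funext => x; exfalso; apply: X0; exists x.
    apply: (addIr (pi 0)); rewrite add0r -(rep_add pi_rep) //.
    by rewrite addr0.
  have eqH (S T : H -> H) : S = T.
    apply/funext => u; have /(congr1 (fun p => p (S u))) := id0.
    by have /(congr1 (fun p => p (T u))) := id0 => /= -> ->.
  split=> [T _|]; first by exists 0; [exact: CM|exact: eqH].
  apply/seteqP; split=> T _.
    by move=> N [_]; apply; exists 0 => //; exact: eqH.
  by exists 0; [exact: CM|exact: eqH].
have ME : M = bounded_measurable (cozero_sets R X).
  exact: monotone_sigma_completionE.
have clM : strongly_closed (piB @` M).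
  move=> T [bT]; rewrite ME => cT.
  have [g bg <-] := rep_strong_closure dot_norm piB_ext x0 bT cT H_separable.
  by exists g.
(* For a von Neumann algebra [N] containing the image of C(X), its preimage is one of the algebras
   that [M] is the intersection of. *)
split => //; apply/seteqP; split=> [_ [f Mf <-] N [vN CN]|].
  have [_ // ] : [set f | bounded_borel_functions f /\ N (piB f)] f.
  apply: Mf; split; first exact: (von_neumann_preimage dot_norm piB_ext x0).
  move=> g cg; split.
    apply: (bounded_measurable_sub (@cozero_open R X)).
    exact: (continuous_bounded_measurable x0 X_compact).
  by rewrite (ext_extends piB_ext) //; apply: CN; exists g.
(* Conversely, the strongly closed image of [M] is itself a von Neumann algebra containing the image
   of C(X). *)
apply: smallest_sub.
  by rewrite ME in clM *; exact: (von_neumann_range dot_norm piB_ext x0 clM).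
move=> _ [f cf <-]; exists f; first exact: CM.
exact: (ext_extends piB_ext).
Qed.
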